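(* For any non-negative real number $T$ and any integer $a$, \[P\left(\|X\|_T\leq p^a\right) = e^{-\sigma\alpha T p^{-ab}},\qquad\text{where } \|X\|_T=\sup_{0\le t\le T}|X_t| \text{ and } \alpha = 1-\frac{p^b-1}{p^{b+1}-1}.\]
   Context: Fix a prime $p$. $\mathbb Q_p$ is the field of $p$-adic numbers with absolute value $|\cdot|$, $\mu$ is the Haar measure on $\mathbb Q_p$ normalized so that $\mu(\mathbb Z_p)=1$ (write $dx$ for $d\mu(x)$). For $x\in\mathbb Q_p$ write $x=\sum_k a_x(k)p^k$ with digits $a_x(k)\in\{0,\dots,p-1\}$, set $\{x\}=\sum_{k<0}a_x(k)p^k$ and $\chi(x)=e^{2\pi i\{x\}}$. Fix positive reals $b$ (the exponent of the Vladimirov operator) and $\sigma$ (the diffusion constant). For $t>0$ let $\rho(t,x)=\int_{\mathbb Q_p}\chi(xy)e^{-\sigma t|y|^b}\,dy$, the fundamental solution of $\frac{d}{dt}f=-\sigma\Delta f$ where $\Delta$ is the Vladimirov operator with symbol $|\xi|^b$; it is a probability density. $P$ is the probability measure on the Skorokhod space $D([0,\infty):\mathbb Q_p)$ of càdlàg $\mathbb Q_p$-valued paths, concentrated on paths with $\omega(0)=0$, whose finite-dimensional distributions are: for $0=t_0<t_1<\dots<t_k$ and Borel $U_1,\dots,U_k$, $P(X_{t_1}\in U_1,\dots,X_{t_k}\in U_k)=\int_{U_1}\cdots\int_{U_k}\prod_{i=1}^k\rho(t_i-t_{i-1},x_i-x_{i-1})\,dx_k\cdots dx_1$ with $x_0=0$.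 Here $X_t(\omega)=\omega(t)$ ($p$-adic Brownian motion). *)

(* Defs.v *)
From HB Require Import structures.
From mathcomp Require Import all_boot all_order all_algebra.
From mathcomp Require Import all_classical all_reals all_analysis.

Set Implicit Arguments.
Unset Strict Implicit.
Unset Printing Implicit Defensive.

Import Order.TTheory GRing.Theory Num.Theory.
Local Open Scope classical_set_scope.
Local Open Scope ring_scope.

(* The p-adic numbers Q_p, represented by their digit expansions            *)
(*   x = sum_k a_x(k) p^k,  a_x(k) in {0,..,p-1},  a_x(k) = 0 for k << 0.     *)
(* (For the prime p of the statement the digit condition is a_x(k) < p; the *)
(*  disjunct "= 0" only matters for the degenerate p = 0 and keeps the type  *)
(*  inhabited in general.)                                                   *)

Definition digit_ok (p n : nat) : bool := (n < p)%N || (n == 0)%N.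

Definition fin_digits (p : nat) (d : int -> nat) : Prop :=
  (forall k, digit_ok p (d k)) /\ exists N : int, forall k : int, k < N -> d k = 0%N.

Record Qp (p : nat) := MkQp { qdig : int -> nat ; qdigP : fin_digits p qdig }.
Arguments qdig {p}.

Lemma zero_fin_digits (p : nat) : fin_digits p (fun _ => 0%N).
Proof. by split => [k|]; [rewrite /digit_ok orbT | exists 0]. Qed.

Definition zeroQ (p : nat) : Qp p := MkQp (zero_fin_digits p).

HB.instance Definition _ (p : nat) := gen_eqMixin (Qp p).
HB.instance Definition _ (p : nat) := gen_choiceMixin (Qp p).
HB.instance Definition _ (p : nat) := isPointed.Build (Qp p) (zeroQ p).

Definition adigit (p : nat) (x : Qp p) (k : int) : nat := qdig x k.

Definition qlow (p : nat) (x : Qp p) : int := projT1 (cid (proj2 (qdigP x))).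

(* truncation  sum_{k < n} a_x(k) p^k  (a rational number) *)
Definition qtrunc (p : nat) (x : Qp p) (n : int) : rat :=
  \sum_(i < `|n - qlow x|%N | qlow x + i%:Z < n)
     (qdig x (qlow x + i%:Z))%:R * (p%:R : rat) ^ (qlow x + i%:Z).

Definition qfrac (p : nat) (x : Qp p) : rat := qtrunc x 0.

(* k-th base-p digit of a nonnegative rational with p-power denominator *)
Definition digq (p : nat) (q : rat) (k : int) : nat :=
  `|(Num.floor (q / (p%:R : rat) ^ k) %% p%:Z)%Z|%N.

(* from a digit function to Q_p (every function below does satisfy
   fin_digits; the default branch is never used) *)
Definition mkQp (p : nat) (d : int -> nat) : Qp p :=
  match pselect (fin_digits p d) with
  | left h => MkQp h
  | right _ => zeroQ p
  end.

(* ring operations of Q_p, computed digitwise from truncations: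
   the digits of index <= k of x+y, -x, xy only depend on x, y modulo
   p^(k+1) Z_p *)
Definition qadd (p : nat) (x y : Qp p) : Qp p :=
  mkQp p (fun k => digq p (qtrunc x (k + 1) + qtrunc y (k + 1)) k).

Definition qopp (p : nat) (x : Qp p) : Qp p :=
  mkQp p (fun k => digq p ((p%:R : rat) ^ (k + 1) - qtrunc x (k + 1)) k).

Definition qsub (p : nat) (x y : Qp p) : Qp p := qadd x (qopp y).

Definition qmul (p : nat) (x y : Qp p) : Qp p :=
  mkQp p (fun k =>
    let M := (`|k|%:Z + 1 + `|qlow x|%:Z + `|qlow y|%:Z)%R in
    digq p (qtrunc x M * qtrunc y M) k).

(* p-adic absolute value: |x| = p^(-v) with v the least index of a nonzero
   digit, |0| = 0 *)
Definition pabs (R : realType) (p : nat) (x : Qp p) : R :=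
  if pselect (exists k, qdig x k <> 0%N)
  then sup [set (p%:R : R) ^ (- k) | k in [set k | qdig x k <> 0%N]]
  else 0.

Definition Zp (R : realType) (p : nat) : set (Qp p) := [set x | pabs R x <= 1].

Definition qopen (R : realType) (p : nat) (A : set (Qp p)) : Prop :=
  forall x, A x -> exists e : R, 0 < e /\ [set y | pabs R (qsub y x) < e] `<=` A.

Definition QpM (R : realType) (p : nat) :=
  g_sigma_algebraType [set A : set (Qp p) | qopen R A].

Definition is_haar (R : realType) (p : nat)
    (mu : {measure set (QpM R p) -> \bar R}) : Prop :=
  (forall (x : Qp p) (A : set (QpM R p)), measurable A ->
      mu [set qadd x y | y in A] = mu A) /\
  mu (@Zp R p) = 1%E.

(* additive character chi(x) = exp(2 pi i {x}); its real part is
   cos(2 pi {x}) *)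
Definition chi_re (R : realType) (p : nat) (x : Qp p) : R :=
  cos (2 * pi * ratr (qfrac x)).
Definition chi_im (R : realType) (p : nat) (x : Qp p) : R :=
  sin (2 * pi * ratr (qfrac x)).

(* rho(t,x) = int chi(xy) exp(-sigma t |y|^b) dy.  The imaginary part
   int chi_im(xy) exp(..) dy vanishes (y -> -y); rho is the real-valued
   probability density, i.e. the real part below. *)
Definition rho (R : realType) (p : nat) (mu : {measure set (QpM R p) -> \bar R})
    (b sigma t : R) (x : Qp p) : R :=
  Rintegral mu setT
    (fun y : QpM R p => chi_re R (qmul x y) * expR (- (sigma * t * (pabs R y `^ b)))).

Definition rho_im (R : realType) (p : nat) (mu : {measure set (QpM R p) -> \bar R})
    (b sigma t : R) (x : Qp p) : R :=
  Rintegral mu setT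
    (fun y : QpM R p => chi_im R (qmul x y) * expR (- (sigma * t * (pabs R y `^ b)))).

Definition cadlag (R : realType) (p : nat) (f : R -> Qp p) : Prop :=
  forall t : R, 0 <= t ->
    (forall e : R, 0 < e -> exists d : R, 0 < d /\
       forall s, t <= s -> s < t + d -> pabs R (qsub (f s) (f t)) < e) /\
    (0 < t -> exists l : Qp p, forall e : R, 0 < e -> exists d : R, 0 < d /\
       forall s, t - d < s -> s < t -> pabs R (qsub (f s) l) < e).

Lemma digq_pow (p : nat) (k : int) : digq p ((p%:R : rat) ^ (k + 1)) k = 0%N.
Proof.
rewrite /digq; case: (posnP p) => [->|p0].
  rewrite !exp0rz; case: (boolP (k == 0)) => [/eqP->|k0] /=.
    by [].
  have -> : ((0%Z)%:~R : rat) = 0 by [].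
  by rewrite invr0 mulr0 floor0 mod0z.
have pn0 : (p%:R : rat) != 0 by rewrite pnatr_eq0 -lt0n.
rewrite expfzDr // expr1z mulrAC mulfV ?expfz_neq0 // mul1r.
by rewrite -[p%:R]/((p%:Z)%:~R) intrKfloor modzz.
Qed.

Lemma digq0 (p : nat) (k : int) : digq p 0 k = 0%N.
Proof. by rewrite /digq mul0r floor0 mod0z. Qed.

Lemma qtrunc_zero p n : qtrunc (zeroQ p) n = 0.
Proof. by rewrite /qtrunc big1 // => i _; rewrite /= mul0r. Qed.

Lemma mkQp0 p : mkQp p (fun _ => 0%N) = zeroQ p.
Proof.
rewrite /mkQp; case: pselect => // h; rewrite /zeroQ; congr MkQp; exact: Prop_irrelevance.
Qed.

Lemma qopp0 p : qopp (zeroQ p) = zeroQ p.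
Proof.
rewrite /qopp (_ : (fun k => _) = fun _ => 0%N) ?mkQp0 //; apply: funext => k.
by rewrite qtrunc_zero subr0 digq_pow.
Qed.

Lemma qsub00 p : qsub (zeroQ p) (zeroQ p) = zeroQ p.
Proof.
rewrite /qsub qopp0 /qadd (_ : (fun k => _) = fun _ => 0%N) ?mkQp0 //; apply: funext => k.
by rewrite !qtrunc_zero addr0 digq0.
Qed.

Lemma pabs0 (R : realType) p : pabs R (zeroQ p) = 0.
Proof. by rewrite /pabs; case: pselect => // -[k]. Qed.

Lemma cadlag0 (R : realType) p : cadlag (fun _ : R => zeroQ p).
Proof.
move=> t _; split => [e e0|t0].
  by exists 1; split => // s _ _; rewrite qsub00 pabs0.
by exists (zeroQ p) => e e0; exists 1; split => // s _ _; rewrite qsub00 pabs0.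
Qed.

(* paths are defined on [0, oo); we extend them by 0 on (-oo, 0) *)
Record Dpath (R : realType) (p : nat) := MkDpath {
  dpath :> R -> Qp p ;
  dpath_neg : forall t : R, t < 0 -> dpath t = zeroQ p ;
  dpath_cadlag : cadlag dpath }.


Definition zeroD (R : realType) (p : nat) : Dpath R p :=
  @MkDpath R p (fun _ => zeroQ p) (fun _ _ => erefl) (@cadlag0 R p).

HB.instance Definition _ (R : realType) (p : nat) := gen_eqMixin (Dpath R p).
HB.instance Definition _ (R : realType) (p : nat) := gen_choiceMixin (Dpath R p).
HB.instance Definition _ (R : realType) (p : nat) := isPointed.Build (Dpath R p) (zeroD R p).

(* the sigma-algebra on D generated by the coordinate maps w |-> w(t)
   (= Borel sigma-algebra of the Skorokhod topology) *)
Definition Dgen (R : realType) (p : nat) : set (set (Dpath R p)) :=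
  [set A : set (Dpath R p) | exists (t : R) (B : set (QpM R p)),
           measurable B /\ A = [set w : Dpath R p | B (dpath w t)]].

Definition DM (R : realType) (p : nat) := g_sigma_algebraType (@Dgen R p).

(* iterated integral
   int_{U_1} ... int_{U_k} prod_i rho(t_i - t_{i-1}, x_i - x_{i-1}) dx_k ... dx_1
   where steps = [(t_1,U_1); ...; (t_k,U_k)], starting from (t0, x0) *)
Fixpoint fdd_dens (R : realType) (p : nat) (mu : {measure set (QpM R p) -> \bar R})
    (b sigma : R) (steps : seq (R * set (QpM R p))) (t0 : R) (x0 : Qp p) : \bar R :=
  match steps with
  | [::] => 1%E
  | (t, U) :: s =>
      (\int[mu]_(x in U)
         ((rho mu b sigma (t - t0) (qsub x x0))%:E * fdd_dens mu b sigma s t x))%E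
  end.

Definition normT (R : realType) (p : nat) (w : Dpath R p) (T : R) : R :=
  sup [set pabs R (dpath w t) | t in `[0, T]].

Definition qalpha (R : realType) (p : nat) (b : R) : R :=
  1 - ((p%:R : R) `^ b - 1) / ((p%:R : R) `^ (b + 1) - 1).

(* Main.v *)
(* The ball U = p^m Z_p with m = -a is a group, so for times on the grid of mesh
   h = T/2^N the event that the path stays in U has probability q(h)^(2^N), where
   q(h) is the integral of rho(h, .) over U.  Integrating the Fourier integral of
   rho over U kills every frequency outside the dual ball p^(-m) Z_p, so q(h) is
   the average of exp(-sigma h |y|^b) over that dual ball, and the average of
   |y|^b there is alpha p^(-ab).  Hence q(h) = 1 - sigma alpha p^(-ab) h + O(h^2)
   and q(h)^(2^N) converges to the announced exponential.  The grid events
   decrease to {||X||_T <= p^a}: U is clopen and paths are right continuous. *)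
Require Import Defs.
From HB Require Import structures.
From mathcomp Require Import all_boot all_order all_algebra.
From mathcomp Require Import all_classical all_reals all_analysis.
From mathcomp Require Import measurable_realfun ring lra zify.
Set Implicit Arguments.
Unset Strict Implicit.
Unset Printing Implicit Defensive.

Import Order.TTheory GRing.Theory Num.Theory.
Import numFieldNormedType.Exports.
Local Open Scope classical_set_scope.
Local Open Scope ring_scope.

(** * Arithmetic of digit expansions *)

(** The power q(h)^(2^N) appears because the integral of rho(h, x - x0) over x in U is the same
    number for every x0 in U: each innermost integral of the iterated integral is then a constant
    and factors out. The constant alpha is a geometric series over spheres: the average of |y|^b
    over p^(-m) Z_p is p^(mb) (1 - 1/p) times the sum over j >= 0 of p^(-j(b+1)), and (1 - 1/p) / (1
    - p^(-(b+1))) = alpha. The O(h^2) term is explicit: |y|^b is bounded on the dual ball, so 1 - u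
    <= exp(-u) <= 1 - u + u^2 can be averaged with u = sigma h |y|^b. Over 2^N steps of length T/2^N
    these errors add up to O(2^(-N)). Elements of Q_p are bare digit sequences, so all their
    arithmetic is carried out on rational truncations modulo powers of p. *)

Section BrownianMotion.
Variables (p : nat) (p_pr : prime p).
Local Notation q := (p%:R : rat).
Implicit Types (n m k : int) (u v w : rat) (x y z : Qp p).

(** Membership in p^n Z. Truncations have p-power denominators, and for such rationals this agrees
    with having p-adic valuation at least n. *)
Definition qint n u : bool := u / q ^ n \is a Num.int.

Lemma q_gt0 : 0 < q. Proof. by rewrite ltr0n prime_gt0. Qed.
Lemma q_neq0 : q != 0. Proof. by rewrite gt_eqF ?q_gt0. Qed.
Lemma qX_gt0 n : 0 < q ^ n. Proof. by rewrite exprz_gt0 ?q_gt0. Qed.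
Lemma qX_neq0 n : q ^ n != 0. Proof. by rewrite gt_eqF ?qX_gt0. Qed.
Lemma qXD n m : q ^ (n + m) = q ^ n * q ^ m.
Proof. by rewrite expfzDr ?q_neq0. Qed.

Lemma qX_int n : 0 <= n -> q ^ n \is a Num.int.
Proof. by case: n => // n _; rewrite rpredX ?natr_int. Qed.

Lemma qint0 n : qint n 0.
Proof. by rewrite /qint mul0r rpred0. Qed.

Lemma qintD n u v : qint n u -> qint n v -> qint n (u + v).
Proof. by rewrite /qint mulrDl; exact: rpredD. Qed.

Lemma qintN n u : qint n u -> qint n (- u).
Proof. by rewrite /qint mulNr rpredN. Qed.

Lemma qintB n u v : qint n u -> qint n v -> qint n (u - v).
Proof. by move=> ? ?; rewrite qintD ?qintN. Qed.

Lemma qint_sym n u v : qint n (u - v) -> qint n (v - u).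
Proof. by move=> /qintN; rewrite opprB. Qed.

Lemma qint_trans n u v w : qint n (u - v) -> qint n (v - w) -> qint n (u - w).
Proof. by move=> h1 h2; have := qintD h1 h2; rewrite addrA subrK. Qed.

Lemma qintM n m u v : qint n u -> qint m v -> qint (n + m) (u * v).
Proof. by rewrite /qint qXD invfM mulrACA; exact: rpredM. Qed.

Lemma qintW n m u : m <= n -> qint n u -> qint m u.
Proof.
move=> mn; rewrite /qint => h.
have -> : u / q ^ m = u / q ^ n * q ^ (n - m).
  have -> : q ^ n = q ^ (n - m) * q ^ m by rewrite -qXD subrK.
  by field; rewrite !qX_neq0.
by rewrite rpredM // qX_int // subr_ge0.
Qed.

Lemma qint_natX n k d : n <= k -> qint n (d%:R * q ^ k).
Proof.
by move=> nk; apply: (@qintW k) => //; rewrite /qint mulfK ?qX_neq0 // natr_int.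
Qed.

Lemma qint_X n k : n <= k -> qint n (q ^ k).
Proof. by move=> nk; have := qint_natX 1 nk; rewrite mul1r. Qed.

Lemma qint_small n u : qint n u -> `|u| < q ^ n -> u = 0.
Proof.
move=> h ult; apply/eqP; rewrite -[_ == 0]negbK; apply/negP => u0.
have := norm_intr_ge1 h; rewrite mulf_neq0 ?invr_eq0 ?qX_neq0 // => /(_ isT).
by rewrite normrM normfV (gtr0_norm (qX_gt0 n)) ler_pdivlMr ?qX_gt0 // mul1r leNgt ult.
Qed.

Lemma qdig_lt x k : (qdig x k < p)%N.
Proof.
have [/(_ k)/orP[//|/eqP->] _] := qdigP x.
by rewrite prime_gt0.
Qed.

Lemma qlowP x k : k < qlow x -> qdig x k = 0%N.
Proof. by move=> kl; rewrite /qlow in kl; case: cid kl => /= N; exact. Qed.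

Lemma qtrunc_eq0 x n : (forall k, k < n -> qdig x k = 0%N) -> qtrunc x n = 0.
Proof. by move=> h; rewrite /qtrunc big1 // => i /h ->; rewrite mul0r. Qed.

Lemma qtrunc_low x n : n <= qlow x -> qtrunc x n = 0.
Proof.
by move=> nl; apply: qtrunc_eq0 => k kn; apply: qlowP; apply: lt_le_trans nl.
Qed.

Lemma qtrunc_nat x (j : nat) : qtrunc x (qlow x + j%:Z) =
  \sum_(i < j) (qdig x (qlow x + i%:Z))%:R * q ^ (qlow x + i%:Z).
Proof.
rewrite /qtrunc (addrC (qlow x) j%:Z) addrK absz_nat.
by apply: eq_big => // i; apply/idP; have := ltn_ord i; lia.
Qed.

Lemma qtruncS x n : qtrunc x (n + 1) = qtrunc x n + (qdig x n)%:R * q ^ n.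
Proof.
have [nl|ln] := ltP n (qlow x).
  by rewrite !qtrunc_low ?(ltW nl) ?qlowP // ?mul0r ?addr0 //; lia.
have [j ->] : exists j : nat, n = qlow x + j%:Z by exists `|n - qlow x|%N; lia.
by rewrite -addrA -PoszD addn1 !qtrunc_nat big_ord_recr.
Qed.

(** Digits are indexed by all of Z; this induction starts at an index below which every digit
    vanishes. *)
Lemma int_ind_from (l : int) (Q : int -> Prop) :
  (forall n, n <= l -> Q n) -> (forall n, l <= n -> Q n -> Q (n + 1)) ->
  forall n, Q n.
Proof.
move=> H0 HS n; have [/H0//|ln] := leP n l.
have [j ->] : exists j : nat, n = l + j%:Z by exists `|n - l|%N; lia.
elim: j => [|j IH]; first by rewrite addr0; exact: H0.
by rewrite -addn1 PoszD addrA; apply: HS => //; lia.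
Qed.

Lemma qtrunc_bnd x n : 0 <= qtrunc x n < q ^ n.
Proof.
elim/(@int_ind_from (qlow x)): n => [n nl|n _ /andP[h0 h1]].
  by rewrite qtrunc_low // lexx qX_gt0.
rewrite qtruncS addr_ge0 ?mulr_ge0 ?ler0n ?(ltW (qX_gt0 n)) //=.
have : ((qdig x n).+1%:R : rat) <= q by rewrite ler_nat; exact: qdig_lt.
rewrite -natr1 qXD expr1z => d.
have := ler_wpM2l (ltW (qX_gt0 n)) d; lra.
Qed.

Lemma qint_trunc_diff x n k : n <= k -> qint n (qtrunc x k - qtrunc x n).
Proof.
move=> nk; have [j ->] : exists j : nat, k = n + j%:Z by exists `|k - n|%N; lia.
elim: j => [|j IH]; first by rewrite addr0 subrr qint0.
rewrite -addn1 PoszD addrA qtruncS addrAC qintD // qint_natX //; lia.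
Qed.

Lemma qint_trunc_low x n : qint (qlow x) (qtrunc x n).
Proof.
have [nl|/ltW ln] := leP n (qlow x); first by rewrite qtrunc_low // qint0.
by have := qint_trunc_diff x ln; rewrite (@qtrunc_low x (qlow x)) // subr0.
Qed.

(** Both truncations lie in [0, p^n), so a difference divisible by p^n is zero. *)
Lemma qtrunc_uniq x y n : qint n (qtrunc x n - qtrunc y n) -> qtrunc x n = qtrunc y n.
Proof.
move=> h; apply/eqP; rewrite -subr_eq0; apply/eqP; apply: qint_small h _.
by have := qtrunc_bnd x n; have := qtrunc_bnd y n; rewrite ltr_norml; lra.
Qed.

Lemma qtrunc0P x n : qint n (qtrunc x n) -> qtrunc x n = 0.
Proof.
move=> h; apply: qint_small h _; have /andP[h0 h1] := qtrunc_bnd x n.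
by rewrite ger0_norm.
Qed.

Lemma Qp_ext x y : (forall n, qint n (qtrunc x n - qtrunc y n)) -> x = y.
Proof.
move=> h; have {}h n := qtrunc_uniq (h n).
have : qdig x = qdig y.
  apply: funext => k; have := h (k + 1); rewrite !qtruncS h => /addrI.
  by move=> /(mulIf (qX_neq0 k))/eqP; rewrite eqr_nat => /eqP.
case: x y {h} => dx hx [dy hy] /= e; subst dy; congr MkQp; exact: Prop_irrelevance.
Qed.

(* Digitwise construction: if s k is a coherent system of residues mod p^(k+1),
   the digits of the s k glue to a p-adic number congruent to all of them. *)
Lemma qtrunc_mk (s : int -> rat) (l : int) :
  (forall k, qint (k + 1) (s (k + 1) - s k)) ->
  (forall k, k < l -> qint (k + 1) (s k)) ->
  forall k, qint (k + 1) (qtrunc (mkQp p (fun k => digq p (s k) k)) (k + 1) - s k).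
Proof.
move=> hc hl.
have dlow k : k < l -> digq p (s k) k = 0%N.
  move=> /hl; rewrite /qint => /intrP[z hz].
  have e : s k / q ^ k = (z * p%:Z)%:~R.
    rewrite intrM -hz qXD expr1z invfM -!mulrA mulVf ?q_neq0 //.
    by rewrite mulr1.
  by rewrite /digq e intrKfloor modzMl.
have fin : fin_digits p (fun k => digq p (s k) k).
  split; last by exists l.
  move=> k; rewrite /digit_ok /digq; apply/orP; left.
  have p0 : p%:Z != 0 by have := prime_gt0 p_pr; lia.
  by have := modz_ge0 (Num.floor (s k / q ^ k)) p0; have := ltz_mod (Num.floor (s k / q ^ k)) p0; lia.
rewrite /mkQp; case: pselect => // hf; set x := MkQp hf.
suff H n : qint n (qtrunc x n - s (n - 1)) by move=> k; have := H (k + 1); rewrite addrK.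
elim/(@int_ind_from l): n => [n nl|n ln IH].
  rewrite qtrunc_eq0 => [|k kn]; last by rewrite /= dlow //; lia.
  by rewrite sub0r; apply: qintN; have := hl (n - 1); rewrite subrK; apply; lia.
have h1 : qint n (qtrunc x n - s n).
  have := hc (n - 1); rewrite subrK => /qint_sym h; exact: qint_trans h.
rewrite addrK qtruncS.
move: h1; rewrite /qint => /intrP[m hm].
have sn : s n = qtrunc x n - m%:~R * q ^ n by rewrite -hm mulfVK ?qX_neq0 //; ring.
(* The truncation already built lies in [0, p^n), so it adds nothing to the integer part; the new
   digit is therefore [- m] modulo p, which is what the congruence modulo p^(n+1) requires. *)
have fl : Num.floor (s n / q ^ n) = - m.
  rewrite sn mulrBl mulfK ?qX_neq0 // -mulrNz addrC floorDzr ?intr_int //.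
  rewrite intrKfloor (floor_def (m := 0)) ?addr0 // add0r.
  have /andP[h0 h1] := qtrunc_bnd x n.
  by rewrite divr_ge0 ?(ltW (qX_gt0 n)) //= ltr_pdivrMr ?qX_gt0 // mul1r.
have p0 : p%:Z != 0 by have := prime_gt0 p_pr; lia.
have -> : (qdig x n)%:R = ((- m) %% p%:Z)%Z%:~R :> rat.
  rewrite /= /digq fl -[RHS]/(_%:~R); have := modz_ge0 (- m) p0.
  by case: (modz _ _) => // a _.
rewrite {1}(_ : ((- m) %% p%:Z)%Z = - m - ((- m) %/ p%:Z)%Z * p%:Z); last first.
  by rewrite {2}(divz_eq (- m) p%:Z) addrC addKr.
rewrite sn; set d := ((- m) %/ _)%Z.
have -> : qtrunc x n + (- m - d * p)%:~R * q ^ n - (qtrunc x n - m%:~R * q ^ n)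
    = - (d%:~R * q ^ (n + 1)).
  by rewrite qXD expr1z intrB intrM mulrNz /=; ring.
by rewrite mulNr rpredN mulfK ?qX_neq0 // intr_int.
Qed.

Lemma qtrunc_add x y n : qint n (qtrunc (qadd x y) n - (qtrunc x n + qtrunc y n)).
Proof.
have := @qtrunc_mk (fun k => qtrunc x (k + 1) + qtrunc y (k + 1))
  (Num.min (qlow x) (qlow y)).
move=> /(_ _ _ (n - 1)); rewrite subrK; apply.
  move=> k; rewrite opprD addrACA; apply: qintD; apply: qint_trunc_diff; lia.
move=> k; rewrite lt_min => /andP[h1 h2].
by rewrite !qtrunc_low ?addr0 ?qint0 //; lia.
Qed.

Lemma qtrunc_opp x n : qint n (qtrunc (qopp x) n + qtrunc x n).
Proof.
have := @qtrunc_mk (fun k => q ^ (k + 1) - qtrunc x (k + 1)) (qlow x).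
move=> /(_ _ _ (n - 1)); rewrite subrK => H.
suff : qint n (qtrunc (qopp x) n - (q ^ n - qtrunc x n)).
  move=> h; have := qintD h (qint_X (lexx n)).
  by rewrite opprB addrA subrK.
apply: H => k; last first.
  by move=> kl; rewrite qtrunc_low ?subr0; [exact: qint_X|lia].
have -> : forall a b c d : rat, a - b - (c - d) = (a - c) - (b - d).
  by move=> *; ring.
apply: qintB; first by apply: qintB; apply: qint_X; lia.
by apply: qint_trunc_diff; lia.
Qed.

(* [qmul] computes digit -1 at precision 2 + |qlow x| + |qlow y|. *)
Lemma qfrac_mul x y m :
  2 + `|qlow x|%:Z + `|qlow y|%:Z <= m ->
  qint 0 (qfrac (qmul x y) - qtrunc x m * qtrunc y m).
Proof.
have swap : forall a b c d : rat, a * b - c * d = a * (b - d) + d * (a - c).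
  by move=> *; ring.
(* Changing the truncation order of one factor alters it by a multiple of p^n1; multiplying by the
   other factor costs at most its lowest exponent. *)
have coh (n1 n2 l : int) : n1 <= n2 -> l <= n1 + qlow x -> l <= n1 + qlow y ->
    qint l (qtrunc x n2 * qtrunc y n2 - qtrunc x n1 * qtrunc y n1).
  move=> n12 l1 l2; rewrite swap; apply: qintD.
    apply: (@qintW (qlow x + n1)); first by rewrite addrC.
    by apply: qintM; rewrite ?qint_trunc_low // qint_trunc_diff.
  apply: (@qintW (qlow y + n1)); first by rewrite addrC.
  by apply: qintM; rewrite ?qint_trunc_low // qint_trunc_diff.
pose M k := `|k|%:Z + 1 + `|qlow x|%:Z + `|qlow y|%:Z.
move=> hm.
have := @qtrunc_mk (fun k => qtrunc x (M k) * qtrunc y (M k)) (qlow x + qlow y).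
move=> /(_ _ _ (- 1)) H.
apply: (@qint_trans _ _ (qtrunc x (M (-1)) * qtrunc y (M (-1)))).
  apply: H => k; last first.
    by move=> kl; apply: (@qintW (qlow x + qlow y)); [lia|apply: qintM; exact: qint_trunc_low].
  (* Because of the absolute value, [M] decreases on negative k, so either truncation may be the
     finer one. *)
  have [le|/ltW le] := leP (M k) (M (k + 1)).
    by apply: coh => //; rewrite /M; lia.
  by apply: qint_sym; apply: coh => //; rewrite /M in le *; lia.
by apply: qint_sym; apply: coh; rewrite /M; lia.
Qed.

Lemma qaddC x y : qadd x y = qadd y x.
Proof. by rewrite /qadd; congr mkQp; apply: funext => k; rewrite addrC. Qed.

Lemma qmulC x y : qmul x y = qmul y x.
Proof.
rewrite /qmul; congr mkQp; apply: funext => k /=.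
by rewrite mulrC addrAC.
Qed.

(* x is congruent to the rational u modulo p^n Z_p. *)
Definition cg n x u := qint n (qtrunc x n - u).

Lemma cg_trunc n x : cg n x (qtrunc x n).
Proof. by rewrite /cg subrr qint0. Qed.

Lemma cgD n x y u v : cg n x u -> cg n y v -> cg n (qadd x y) (u + v).
Proof.
move=> hx hy; apply: (qint_trans (qtrunc_add x y n)).
by rewrite opprD addrACA; exact: qintD.
Qed.

Lemma cgN n x u : cg n x u -> cg n (qopp x) (- u).
Proof.
move=> hx; rewrite /cg opprK.
have := qintB (qtrunc_opp x n) hx.
have -> // : forall a b c : rat, a + b - (b - c) = a + c by move=> *; ring.
Qed.

Lemma cgB n x y u v : cg n x u -> cg n y v -> cg n (qsub x y) (u - v).
Proof. by move=> hx hy; apply: cgD => //; exact: cgN. Qed.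

(** Transfer principle: a group identity in Q_p follows once both sides are congruent to a common
    rational at every precision, and the matching identity among rationals is immediate. *)
Lemma cg_ext x y : (forall n, exists2 u, cg n x u & cg n y u) -> x = y.
Proof.
move=> h; apply: Qp_ext => n; have [u hx hy] := h n.
exact: qint_trans hx (qint_sym hy).
Qed.

Lemma qsub_addK x y : qsub (qadd x y) x = y.
Proof.
apply: cg_ext => n; exists (qtrunc x n + qtrunc y n - qtrunc x n).
  by apply: cgB; [apply: cgD|]; exact: cg_trunc.
by rewrite addrC addKr; exact: cg_trunc.
Qed.

Lemma qadd_subK x y : qadd x (qsub y x) = y.
Proof.
apply: cg_ext => n; exists (qtrunc x n + (qtrunc y n - qtrunc x n)).
  by apply: cgD; [|apply: cgB]; exact: cg_trunc.
by rewrite addrC subrK; exact: cg_trunc.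
Qed.

Lemma qopp_addK x y : qadd (qopp x) (qadd x y) = y.
Proof. by rewrite qaddC; exact: qsub_addK. Qed.

Lemma qadd_oppK x y : qadd x (qadd (qopp x) y) = y.
Proof. by rewrite (qaddC (qopp x)); exact: qadd_subK. Qed.

Lemma qsubBB x y z : qsub (qsub x z) (qsub y z) = qsub x y.
Proof.
apply: cg_ext => n; exists (qtrunc x n - qtrunc z n - (qtrunc y n - qtrunc z n)).
  by do 2 apply: cgB; exact: cg_trunc.
have -> : forall a b c : rat, a - c - (b - c) = a - b by move=> *; ring.
by apply: cgB; exact: cg_trunc.
Qed.

(* p^n Z_p, the ball of radius p^(-n): larger n means a smaller ball. *)
Definition ball_ n : set (Qp p) := [set x | cg n x 0].

Lemma ball_truncE n x : ball_ n x <-> qtrunc x n = 0.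
Proof.
rewrite /ball_ /cg /= subr0; split; first exact: qtrunc0P.
by move=> ->; exact: qint0.
Qed.

Lemma ball_digP n x : ball_ n x <-> forall k, k < n -> qdig x k = 0%N.
Proof.
rewrite ball_truncE; split; last exact: qtrunc_eq0.
move=> h k kn; have h1 : qtrunc x (k + 1) = 0.
  apply: qtrunc0P; have := @qint_trunc_diff x (k + 1) n; rewrite h sub0r.
  by move=> /(_ ltac:(lia))/qintN; rewrite opprK.
have /andP[h0 _] := qtrunc_bnd x k.
move: h1; rewrite qtruncS; move/eqP; rewrite paddr_eq0 // ?mulr_ge0 ?ler0n ?(ltW (qX_gt0 k)) //.
by rewrite mulf_eq0 (negbTE (qX_neq0 _)) orbF pnatr_eq0 => /andP[_ /eqP].
Qed.

Lemma ballD n x y : ball_ n x -> ball_ n y -> ball_ n (qadd x y).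
Proof. by move=> hx hy; have := cgD hx hy; rewrite addr0. Qed.

Lemma ballB n x y : ball_ n x -> ball_ n y -> ball_ n (qsub x y).
Proof. by move=> hx hy; have := cgB hx hy; rewrite subr0. Qed.

Lemma ballW n m x : m <= n -> ball_ n x -> ball_ m x.
Proof.
move=> mn /ball_digP h; apply/ball_digP => k km; apply: h; exact: lt_le_trans mn.
Qed.

Lemma ball_sub_sym n x y : ball_ n (qsub x y) -> ball_ n (qsub y x).
Proof.
move=> h; have := cgB (cgB (cg_trunc n y) (cg_trunc n y)) h.
rewrite subrr subr0; suff -> : qsub (qsub y y) (qsub x y) = qsub y x by [].
exact: qsubBB.
Qed.

Lemma ball_qlow x : ball_ (qlow x) x.
Proof. by apply/ball_digP; exact: qlowP. Qed.

Lemma ball_zero n : ball_ n (zeroQ p).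
Proof. by apply/ball_digP. Qed.

(** The elements d p^n represent the cosets of p^(n+1) Z_p in p^n Z_p; d = 1 also provides the test
    point for nontriviality of the character. *)
Lemma monomial_ex n (d : nat) : (d < p)%N ->
  exists c : Qp p, ball_ n c /\ forall m, n < m -> qtrunc c m = d%:R * q ^ n.
Proof.
move=> dp.
have fin : fin_digits p (fun k => if k == n then d else 0%N).
  split=> [k|]; first by rewrite /digit_ok; case: ifP; rewrite ?dp ?orbT.
  by exists n => k kn; rewrite lt_eqF.
exists (MkQp fin); split; first by apply/ball_digP => k kn /=; rewrite lt_eqF.
have h0 m : m <= n -> qtrunc (MkQp fin) m = 0.
  by move=> mn; apply: qtrunc_eq0 => k km /=; rewrite lt_eqF //; lia.
elim/(@int_ind_from n) => [m mn|m nm IH _]; first by lia.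
rewrite qtruncS /=; move: nm; rewrite le_eqVlt => /orP[/eqP<-|nm].
  by rewrite eqxx h0 // add0r.
by rewrite gt_eqF // mul0r addr0; exact: IH.
Qed.


Local Opaque qadd qopp qsub qmul.

Lemma qsub_add3 x y z : qadd (qsub y x) (qsub x z) = qsub y z.
Proof.
apply: cg_ext => n; exists (qtrunc y n - qtrunc x n + (qtrunc x n - qtrunc z n)).
  by apply: cgD; apply: cgB; exact: cg_trunc.
by rewrite addrA subrK; apply: cgB; exact: cg_trunc.
Qed.

Lemma cg_zero n : cg n (zeroQ p) 0.
Proof. exact: ball_zero. Qed.

Lemma qsubx0 x : qsub x (zeroQ p) = x.
Proof.
apply: cg_ext => n; exists (qtrunc x n); last exact: cg_trunc.
by rewrite -[X in cg _ _ X]subr0; apply: cgB; [exact: cg_trunc|exact: cg_zero].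
Qed.

(** Ultrametric principle: two points of the same coset of p^n Z_p are interchangeable when testing
    membership in a coset. *)
Lemma ball_sub_trans n x y z :
  ball_ n (qsub y x) -> ball_ n (qsub y z) <-> ball_ n (qsub x z).
Proof.
move=> yx; split => h.
  by rewrite -(qsub_add3 y x z); exact: ballD (ball_sub_sym yx) h.
by rewrite -(qsub_add3 x y z); exact: ballD yx h.
Qed.

Lemma ball_sub n x z : ball_ n z -> ball_ n (qsub x z) <-> ball_ n x.
Proof.
move=> hz; split => h; last exact: ballB.
by rewrite -(qadd_subK z x); exact: ballD hz h.
Qed.

Lemma ball_all_eq0 x : (forall n, ball_ n x) -> x = zeroQ p.
Proof. by move=> h; apply: cg_ext => n; exists 0; [exact: h|exact: cg_zero]. Qed.

(** * Absolute value and Haar measure *)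

Variable R : realType.
Local Notation pR := (p%:R : R).

Lemma pR_gt1 : 1 < pR. Proof. by rewrite ltr1n prime_gt1. Qed.
Lemma pR_gt0 : 0 < pR. Proof. by rewrite ltr0n prime_gt0. Qed.
Lemma pR_neq0 : pR != 0. Proof. by rewrite gt_eqF ?pR_gt0. Qed.
Lemma pRX_gt0 n : 0 < pR ^ n. Proof. by rewrite exprz_gt0 ?pR_gt0. Qed.
Lemma pRXD n m : pR ^ (n + m) = pR ^ n * pR ^ m.
Proof. by rewrite expfzDr ?pR_neq0. Qed.

Lemma pabs_ge0 x : 0 <= pabs R x.
Proof.
rewrite /pabs; case: pselect => // -[k hk].
apply: le_trans (ltW (pRX_gt0 (- k))) _; apply: ub_le_sup; last by exists k.
exists (pR ^ (- qlow x)) => _ [m /= hm <-].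
rewrite ler_eXz2l ?pR_gt1 // lerN2 leNgt; apply/negP => /qlowP; exact: hm.
Qed.

Lemma pabs_dig x k : qdig x k <> 0%N -> pR ^ (- k) <= pabs R x.
Proof.
move=> hk; rewrite /pabs; case: pselect => [hex|[]]; last by exists k.
apply: ub_le_sup; last by exists k.
exists (pR ^ (- qlow x)) => _ [m /= hm <-].
rewrite ler_eXz2l ?pR_gt1 // lerN2 leNgt; apply/negP => /qlowP; exact: hm.
Qed.

Lemma pabs_leP n x : pabs R x <= pR ^ (- n) <-> ball_ n x.
Proof.
rewrite ball_digP; split.
  move=> h k kn; apply: contrapT => /pabs_dig /le_trans/(_ h).
  by rewrite ler_eXz2l ?pR_gt1 // lerN2 leNgt kn.
move=> h; rewrite /pabs; case: pselect => [[k hk]|hno]; last exact: ltW (pRX_gt0 _).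
apply: ge_sup; first by exists (pR ^ (- k)); exists k.
move=> _ [m /= hm <-]; rewrite ler_eXz2l ?pR_gt1 // lerN2 leNgt.
by apply/negP => /h; exact: hm.
Qed.

Lemma pabs_shell n x : ball_ n x -> ~ ball_ (n + 1) x -> pabs R x = pR ^ (- n).
Proof.
move=> hn hn1; apply/eqP; rewrite eq_le; apply/andP; split; first exact/pabs_leP.
apply: pabs_dig => h0; apply: hn1; apply/ball_digP => k kn.
have [kn'|nk] := ltP k n; first by move/ball_digP: hn; apply.
by have -> : k = n by lia.
Qed.

Lemma shell_ex x : x <> zeroQ p -> exists n, ball_ n x /\ ~ ball_ (n + 1) x.
Proof.
move=> x0; apply: contrapT => H; apply: x0; apply: ball_all_eq0.
apply: (@int_ind_from (qlow x)) => [n nl|n _ h]; first exact: ballW (ball_qlow x).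
by apply: contrapT => h1; apply: H; exists n.
Qed.

Lemma qopen_ball (A : set (Qp p)) :
  (forall x, A x -> exists n, forall y, ball_ n (qsub y x) -> A y) -> qopen R A.
Proof.
move=> h x /h[n hn]; exists (pR ^ (- n)); split; first exact: pRX_gt0.
by move=> y /= /ltW /pabs_leP; exact: hn.
Qed.

Lemma measurable_ball_open (A : set (QpM R p)) :
  (forall x : Qp p, A x -> exists n, forall y, ball_ n (qsub y x) -> A y) ->
  measurable A.
Proof. by move=> h; apply: sub_sigma_algebra; exact: qopen_ball. Qed.

(* The origin is excluded so that radial functions are covered too. *)
Lemma measurable_loc_cst d' (T' : measurableType d') (f : QpM R p -> T') :
  (forall x : Qp p, x <> zeroQ p ->
     exists n, forall y, ball_ n (qsub y x) -> f y = f x) ->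
  measurable_fun setT f.
Proof.
move=> h _ Y mY; rewrite setTI.
have m0 : measurable ([set zeroQ p] : set (QpM R p)).
  rewrite -[[set _]]setCK; apply: measurableC; apply: measurable_ball_open => x /= x0.
  have [n [_ hn]] := shell_ex x0; exists (n + 1) => y yx y0; apply: hn.
  by rewrite -(qsubx0 x) -y0; exact: ball_sub_sym.
have mo : measurable ((f @^-1` Y) `\` [set zeroQ p] : set (QpM R p)).
  apply: measurable_ball_open => x [/= fx x0].
  have [m hm] := h _ x0; have [n [_ hn]] := shell_ex x0.
  exists (Num.max m (n + 1)) => y yx; split => /=.
    by rewrite hm //; apply: ballW yx; rewrite le_max lexx.
  move=> y0; apply: hn; apply: (@ballW (Num.max m (n + 1))).
    by rewrite le_max lexx orbT.
  by rewrite -(qsubx0 x) -y0; exact: ball_sub_sym.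
have [f0|f0] := pselect ((f @^-1` Y) (zeroQ p)).
  rewrite (_ : f @^-1` Y = ((f @^-1` Y) `\` [set zeroQ p]) `|` [set zeroQ p]).
    exact: measurableU.
  by rewrite setUC setDUK // => _ ->.
rewrite (_ : f @^-1` Y = (f @^-1` Y) `\` [set zeroQ p]) //.
by rewrite setDidl //; apply/seteqP; split => // x [/= fx x0]; apply: f0; rewrite -x0.
Qed.

(** * Haar measure of balls and cosets *)

Definition coset_ n x0 : set (QpM R p) := [set x : Qp p | ball_ n (qsub x x0)].

Lemma coset0 n : coset_ n (zeroQ p) = ball_ n.
Proof. by apply/seteqP; split => x; rewrite /coset_ /= qsubx0. Qed.

Lemma measurable_coset n x0 : measurable (coset_ n x0).
Proof.
apply: measurable_ball_open => x hx; exists n => y yx.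
exact: (ball_sub_trans x0 yx).2 hx.
Qed.

Lemma measurable_ball n : measurable (ball_ n : set (QpM R p)).
Proof. by have := measurable_coset n (zeroQ p); rewrite coset0. Qed.

Variable mu : {measure set (QpM R p) -> \bar R}.
Hypothesis muH : is_haar mu.

Lemma mu_coset n x0 : mu (coset_ n x0) = mu (ball_ n).
Proof.
rewrite -(muH.1 x0 _ (measurable_ball n)); congr (mu _).
apply/seteqP; split => x.
  by move=> hx; exists (qsub x x0) => //; exact: qadd_subK.
by move=> [y hy <-]; rewrite /coset_ /= qsub_addK.
Qed.

(** The n-th digit splits p^n Z_p into p translates of p^(n+1) Z_p, all of the same mass by
    invariance. *)
Lemma mu_ball_rec n : mu (ball_ n) = (pR%:E * mu (ball_ (n + 1)))%E.
Proof.
(* Prescribing the whole truncation fixes digit n and also forces all lower digits to vanish. *)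
pose D (d : nat) : set (QpM R p) := [set x : Qp p | qtrunc x (n + 1) = d%:R * q ^ n].
have mD d : measurable (D d).
  apply: measurable_ball_open => x; rewrite /D /= => hx; exists (n + 1) => y yx.
  rewrite -hx; apply: qtrunc_uniq.
  have := cgD yx (cg_trunc (n + 1) x); rewrite add0r.
  by rewrite (_ : qadd _ x = y) // qaddC; exact: qadd_subK.
have tD : trivIset setT D.
  apply/trivIsetP => i j _ _ ij; apply/seteqP; split => // x [] /=; rewrite /D /= => ->.
  by move=> /(mulIf (qX_neq0 n))/eqP; rewrite eqr_nat (negbTE ij).
have muD d : (d < p)%N -> mu (D d) = mu (ball_ (n + 1)).
  move=> dp; have [c [_ hc]] := monomial_ex n dp.
  rewrite -(mu_coset (n + 1) c); congr (mu _); apply/seteqP; split => x.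
    rewrite /D /coset_ /= => hx; have := cgB (cg_trunc (n + 1) x) (cg_trunc (n + 1) c).
    by rewrite hx hc ?subrr //; lia.
  rewrite /D /coset_ /= => hx; have := cgD (cg_trunc (n + 1) c) hx.
  rewrite qadd_subK addr0 => /qtrunc_uniq ->; apply: hc; lia.
have -> : ball_ n = \big[setU/set0]_(d < p) D d.
  rewrite -bigcup_mkord; apply/seteqP; split => x.
    move=> hx; exists (qdig x n); first exact: qdig_lt.
    by rewrite /D /= qtruncS; move/ball_truncE: hx => ->; rewrite add0r.
  move=> [d _]; rewrite /D /= => hx; apply/ball_truncE; apply: qtrunc0P.
  have := @qint_trunc_diff x n (n + 1); rewrite hx => /(_ ltac:(lia)) /qintN.
  move=> h; have := qintD h (qint_natX d (lexx n)).
  by rewrite opprB subrK.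
rewrite measure_bigsetU // (eq_bigr (fun=> mu (ball_ (n + 1)))); last by move=> i _; exact: muD.
by rewrite sumr_const card_ord mule_natl.
Qed.

Lemma mu_ball n : mu (ball_ n) = (pR ^ (- n))%:E.
Proof.
have E0 : mu (ball_ 0) = 1%E.
  rewrite -[RHS]muH.2; congr (mu _); apply/seteqP; split => x; rewrite /Zp /=.
    by move=> /pabs_leP; rewrite oppr0 expr0z.
  by move=> h; apply/pabs_leP; rewrite oppr0 expr0z.
have E j : mu (ball_ (- j%:Z)) = (pR ^ j%:Z)%:E.
  elim: j => [|j IH]; first by rewrite oppr0 E0.
  rewrite mu_ball_rec (_ : - j.+1%:Z + 1 = - j%:Z); last by lia.
  by rewrite IH -EFinM -[in RHS]addn1 PoszD pRXD expr1z mulrC.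
have E' j : mu (ball_ j%:Z) = (pR ^ (- j%:Z))%:E.
  elim: j => [|j IH]; first by rewrite oppr0 E0.
  have := mu_ball_rec j%:Z; rewrite IH (_ : j%:Z + 1 = j.+1%:Z); last by lia.
  move=> h; have : ((pR^-1)%:E * (pR ^ (- j%:Z))%:E)%E = mu (ball_ j.+1%:Z).
    by rewrite h muleA -EFinM mulVf ?pR_neq0 // mul1e.
  move=> <-; rewrite -EFinM; congr (_%:E).
  by rewrite (_ : - j.+1%:Z = - 1 + - j%:Z) ?pRXD ?exprN1 //; lia.
by case: n => j; [exact: E'|rewrite NegzE E opprK].
Qed.

Lemma fine_mu_coset n x0 : fine (mu (coset_ n x0)) = pR ^ (- n).
Proof. by rewrite mu_coset mu_ball. Qed.


(** * The additive character *)

Let th (u : rat) : R := 2 * pi * ratr u.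

Lemma trig_qint u v : qint 0 (u - v) -> cos (th u) = cos (th v) /\ sin (th u) = sin (th v).
Proof.
rewrite /qint expr0z divr1 => /intrP[z hz].
have -> : th u = th v + (pi *+ 2) * z%:~R.
  have -> : u = v + z%:~R by rewrite -hz addrC subrK.
  by rewrite /th rmorphD /= ratr_int mulrDr mulr2n; congr (_ + _); ring.
case: z hz => n _.
  rewrite -[_%:~R]/(n%:R) mulr_natr.
  by split; [rewrite (periodicn (@cosD2pi R))|rewrite (periodicn (@sinD2pi R))].
rewrite NegzE mulrNz mulrN mulr_natr; set a := th v.
have ea : a = a - pi *+ 2 *+ n.+1 + pi *+ 2 *+ n.+1 by rewrite subrK.
by split; rewrite [in RHS]ea; [rewrite (periodicn (@cosD2pi R))|rewrite (periodicn (@sinD2pi R))].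
Qed.

(** The fractional part f of u lies in (0, 1), and cos(2 pi f) = 1 - 2 sin(pi f)^2 with sin(pi f) >
    0. *)
Lemma cos_not_qint u : ~~ qint 0 u -> cos (th u) != 1.
Proof.
move=> nu; apply/eqP => c1.
pose f : rat := u - (Num.floor u)%:~R.
have [cf _] : cos (th u) = cos (th f) /\ sin (th u) = sin (th f).
  by apply: trig_qint; rewrite /f opprB addrC subrK /qint expr0z divr1 intr_int.
have f0 : 0 < f.
  rewrite lt_def subr_eq0 subr_ge0 ge_floor andbT; apply: contra nu => /eqP ->.
  by rewrite /qint expr0z divr1 intr_int.
have f1 : f < 1 by have /andP[_] := floor_itv u; rewrite intrD /f; lra.
have : 0 < sin (pi * ratr f : R).
  apply: sin_gt0_pi; rewrite mulr_gt0 ?pi_gt0 ?ltr0q //=.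
  by rewrite gtr_pMr ?pi_gt0 // -[1](rmorph1 (@ratr R)) ltr_rat.
have := cos_mulr2n (pi * ratr f : R); rewrite (_ : _ *+ 2 = th f); last first.
  by rewrite /th mulr2n; ring.
rewrite -cf c1 cos2sin2 => e; suff -> : sin (pi * ratr f : R) = 0 by rewrite ltxx.
by apply/eqP; rewrite -sqrf_eq0; apply/eqP; lra.
Qed.

(** The kernel only uses the real part, but the addition formulas mix it with the imaginary part, so
    both are carried along. *)
Definition re_chi x y : R := chi_re R (qmul x y).
Definition im_chi x y : R := chi_im R (qmul x y).

Lemma thD u v : th (u + v) = th u + th v.
Proof. by rewrite /th rmorphD mulrDr. Qed.

Lemma re_chiE x y : re_chi x y = cos (th (qfrac (qmul x y))). Proof. by []. Qed.
Lemma im_chiE x y : im_chi x y = sin (th (qfrac (qmul x y))). Proof. by []. Qed.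

Lemma qfrac_mulD x y z :
  qint 0 (qfrac (qmul x (qadd y z)) - (qfrac (qmul x y) + qfrac (qmul x z))).
Proof.
(* One precision that suits all three products. The index [qlow (qadd y z)] is merely a chosen lower
   bound, unrelated to those of y and z, hence its own term. *)
pose m := 2 + `|qlow x|%:Z + `|qlow y|%:Z + `|qlow z|%:Z + `|qlow (qadd y z)|%:Z.
have h1 : qint 0 (qfrac (qmul x (qadd y z)) - qtrunc x m * qtrunc (qadd y z) m).
  by apply: qfrac_mul; rewrite /m; lia.
have h2 : qint 0 (qfrac (qmul x y) - qtrunc x m * qtrunc y m).
  by apply: qfrac_mul; rewrite /m; lia.
have h3 : qint 0 (qfrac (qmul x z) - qtrunc x m * qtrunc z m).
  by apply: qfrac_mul; rewrite /m; lia.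
have h4 : qint 0 (qtrunc x m * (qtrunc (qadd y z) m - (qtrunc y m + qtrunc z m))).
  apply: (@qintW (qlow x + m)); first by rewrite /m; lia.
  by apply: qintM; [exact: qint_trunc_low|exact: qtrunc_add].
have := qintB (qintD h1 h4) (qintD h2 h3).
by have -> // : forall a t b s c d e : rat,
  a - t * b + t * (b - (c + d)) - (e - t * c + (s - t * d)) = a - (e + s)
  by move=> *; ring.
Qed.

Lemma re_chiD x y z : re_chi x (qadd y z) = re_chi x y * re_chi x z - im_chi x y * im_chi x z.
Proof.
have [h _] := trig_qint (qfrac_mulD x y z).
by move: h; rewrite thD cosD.
Qed.

Lemma im_chiD x y z : im_chi x (qadd y z) = im_chi x y * re_chi x z + re_chi x y * im_chi x z.
Proof.
have [_ h] := trig_qint (qfrac_mulD x y z).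
by move: h; rewrite thD sinD.
Qed.

Lemma re_chiC x y : re_chi x y = re_chi y x. Proof. by rewrite /re_chi qmulC. Qed.

(** Duality of p^n Z_p and p^(-n) Z_p: the product xy lies in Z_p, where the character is
    trivial. *)
Lemma re_chi_unit n x y : ball_ n x -> ball_ (- n) y -> re_chi x y = 1 /\ im_chi x y = 0.
Proof.
move=> hx hy; pose m := 2 + `|qlow x|%:Z + `|qlow y|%:Z + `|n|%:Z.
have h : qint 0 (qfrac (qmul x y) - qtrunc x m * qtrunc y m).
  by apply: qfrac_mul; rewrite /m; lia.
have tr k z : ball_ k z -> k <= m -> qint k (qtrunc z m).
  move=> /ball_truncE hz km; have := qint_trunc_diff z km.
  by rewrite hz subr0.
have h2 : qint 0 (qtrunc x m * qtrunc y m).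
  by rewrite -(subrr n); apply: qintM; apply: tr => //; rewrite /m; lia.
have h3 : qint 0 (qfrac (qmul x y) - 0) by have := qintD h h2; rewrite subrK subr0.
have [hc hs] := trig_qint h3.
rewrite re_chiE im_chiE hc hs /th.
by rewrite rmorph0 mulr0 cos0 sin0.
Qed.

(** The witness is y = p^(-n): if x p^(-n) had integral fractional part, then x would lie in p^n
    Z_p. *)
Lemma re_chi_nontrivial n x : ~ ball_ n x -> exists2 y, ball_ (- n) y & re_chi x y != 1.
Proof.
move=> hx; have [y [hy ty]] := @monomial_ex (- n) 1 (prime_gt1 p_pr).
exists y => //; apply: cos_not_qint; apply/negP => h; apply: hx; rewrite ball_truncE.
pose m := 2 + `|qlow x|%:Z + `|qlow y|%:Z + `|n|%:Z.
have h1 : qint 0 (qfrac (qmul x y) - qtrunc x m * qtrunc y m).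
  by apply: qfrac_mul; rewrite /m; lia.
have := qintB h h1; rewrite opprB addrC subrK ty; last by rewrite /m; lia.
rewrite mul1r => h2; apply: qtrunc0P.
have := qintM h2 (qint_X (lexx n)).
rewrite add0r -mulrA -qXD addNr expr0z mulr1 => h3.
have nm : n <= m by rewrite /m; lia.
by have := qintB h3 (qint_trunc_diff x nm); rewrite opprB addrC subrK.
Qed.

Lemma re_chi_le1 x y : `|re_chi x y| <= 1. Proof. exact: cos_max. Qed.

Lemma re_chi_loc n x y z : ball_ n x -> ball_ (- n) (qsub z y) ->
  re_chi x z = re_chi x y /\ im_chi x z = im_chi x y.
Proof.
move=> hx hzy; have [c s] := re_chi_unit hx hzy.
rewrite -(qadd_subK y z) re_chiD im_chiD c s.
by rewrite !mulr1 !mulr0 subr0 addr0.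
Qed.

Lemma measurable_re_chi x : measurable_fun setT (re_chi x : QpM R p -> R).
Proof.
apply: measurable_loc_cst => y _; exists (- qlow x) => z hz.
exact: (re_chi_loc (ball_qlow x) hz).1.
Qed.

Lemma measurable_im_chi x : measurable_fun setT (im_chi x : QpM R p -> R).
Proof.
apply: measurable_loc_cst => y _; exists (- qlow x) => z hz.
exact: (re_chi_loc (ball_qlow x) hz).2.
Qed.

Lemma integrable_coset n x0 (f : QpM R p -> R) (M : R) :
  measurable_fun setT f -> (forall x, coset_ n x0 x -> `|f x| <= M) ->
  mu.-integrable (coset_ n x0) (EFin \o f).
Proof.
move=> mf hM; apply: measurable_bounded_integrable.
- exact: measurable_coset.
- by rewrite mu_coset mu_ball ltry.
- exact: measurable_funTS.
- exists M; split; first exact: num_real.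
  by move=> N MN x /= hx; apply: le_trans (hM _ hx) (ltW MN).
Qed.

Lemma integrable_ball n (f : QpM R p -> R) (M : R) :
  measurable_fun setT f -> (forall x, ball_ n x -> `|f x| <= M) ->
  mu.-integrable (ball_ n) (EFin \o f).
Proof. by rewrite -coset0; exact: integrable_coset. Qed.

Lemma qsub_qadd x y z : qsub (qadd x y) (qadd x z) = qsub y z.
Proof.
apply: cg_ext => n; exists (qtrunc x n + qtrunc y n - (qtrunc x n + qtrunc z n)).
  by apply: cgB; apply: cgD; exact: cg_trunc.
by rewrite opprD addrACA subrr add0r; apply: cgB; exact: cg_trunc.
Qed.

Lemma measurable_qadd x0 : measurable_fun setT (qadd x0 : QpM R p -> QpM R p).
Proof.
apply: (@measurability _ _ (QpM R p) (QpM R p) setT (qadd x0)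
  [set A : set (Qp p) | qopen R A]) => //.
move=> _ [A oA <-]; rewrite setTI; apply: sub_sigma_algebra => x /= /oA[e [e0 he]].
exists e; split; first exact: e0.
move=> y hy; have hy' : pabs R (qsub (qadd x0 y) (qadd x0 x)) < e by rewrite qsub_qadd; exact: hy.
exact: he hy'.
Qed.

Lemma mu_preimage_qadd x0 (A : set (QpM R p)) :
  measurable A -> mu (qadd x0 @^-1` A) = mu A.
Proof.
move=> mA; rewrite -(muH.1 (qopp x0) _ mA); congr (mu _).
apply/seteqP; split => x /=.
  by move=> hx; exists (qadd x0 x) => //; exact: qopp_addK.
by move=> [y hy <-]; rewrite qadd_oppK.
Qed.

Lemma Rintegral_ball_shift n x0 (f : QpM R p -> R) (M : R) :
  measurable_fun setT f -> (forall x, `|f x| <= M) -> ball_ n x0 ->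
  Rintegral mu (ball_ n) (f \o qadd x0) = Rintegral mu (ball_ n) f.
Proof.
move=> mf hM hx0; rewrite /Rintegral; congr fine.
have pre : (qadd x0 : QpM R p -> QpM R p) @^-1` (ball_ n) = ball_ n.
  apply/seteqP; split => x /= hx; last exact: ballD.
  by rewrite -(qsub_addK x0 x); exact: ballB.
transitivity (\int[pushforward mu (qadd x0 : QpM R p -> QpM R p)]_(y in ball_ n) (f y)%:E)%E; last first.
  apply: eq_measure_integral; first exact: measurable_qadd.
  by move=> mq A mA _; exact: (mu_preimage_qadd x0 mA).
have mq := measurable_qadd x0.
rewrite (@integral_pushforward _ _ _ _ _ _ mq) ?pre //.
- exact/measurable_EFinP.
- apply: (@integrable_ball _ (f \o qadd x0) M); last by move=> x _; exact: hM.
  exact: measurableT_comp.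
- exact: measurable_ball.
Qed.

(* Translating by y0 in the ball multiplies the vector of integrals (I, J) of
   (cos, sin) by a rotation, which is nontrivial for a suitable y0 when x is
   not in p^n Z_p; hence I = J = 0. *)
Lemma Rintegral_re_chi n x :
  Rintegral mu (ball_ (- n)) (re_chi x) = if pselect (ball_ n x) then pR ^ n else 0.
Proof.
case: pselect => hx.
  rewrite (@eq_Rintegral _ _ _ mu _ (cst 1)); last first.
    by move=> y; rewrite inE => hy; exact: (re_chi_unit hx hy).1.
  rewrite Rintegral_cst; last exact: measurable_ball.
  by rewrite mu_ball opprK mul1r.
have [y0 hy0 c1] := re_chi_nontrivial hx.
set c := re_chi x y0 in c1; pose s := im_chi x y0.
have mc := measurable_re_chi x; have ms := measurable_im_chi x.
have bs y : `|im_chi x y| <= 1 by exact: sin_max.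
have mball := measurable_ball (- n).
have iZ (a : R) (f : QpM R p -> R) : measurable_fun setT f -> (forall y, `|f y| <= 1) ->
    mu.-integrable (ball_ (- n)) (EFin \o (fun y => a * f y)).
  move=> mf bf; apply: (@integrable_ball _ _ `|a|).
    by apply: measurable_funM => //; exact: measurable_cst.
  by move=> y _; rewrite normrM ler_piMr.
have i1 (f : QpM R p -> R) : measurable_fun setT f -> (forall y, `|f y| <= 1) ->
    mu.-integrable (ball_ (- n)) (EFin \o f).
  by move=> mf bf; apply: (@integrable_ball _ _ 1).
pose I := Rintegral mu (ball_ (- n)) (re_chi x).
pose J := Rintegral mu (ball_ (- n)) (im_chi x).
have eI : I = c * I - s * J.
  rewrite {1}/I -(Rintegral_ball_shift mc (re_chi_le1 x) hy0).
  rewrite (@eq_Rintegral _ _ _ mu _ (fun y => c * re_chi x y - s * im_chi x y)); last first.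
    by move=> y _ /=; rewrite re_chiD.
  rewrite RintegralB //; [|by apply: iZ => //; exact: re_chi_le1|exact: iZ].
  by rewrite !RintegralZl //; apply: i1 => //; exact: re_chi_le1.
have eJ : J = s * I + c * J.
  rewrite {1}/J -(Rintegral_ball_shift ms bs hy0).
  rewrite (@eq_Rintegral _ _ _ mu _ (fun y => s * re_chi x y + c * im_chi x y)); last first.
    by move=> y _ /=; rewrite im_chiD.
  rewrite RintegralD //; [|by apply: iZ => //; exact: re_chi_le1|exact: iZ].
  by rewrite !RintegralZl //; apply: i1 => //; exact: re_chi_le1.
(* The factor is the determinant of identity minus rotation; it is nonzero because c differs from
   1. *)
rewrite -/I; have e0 : ((1 - c) ^+ 2 + s ^+ 2) * I = 0.
  transitivity ((1 - c) * (I - (c * I - s * J)) - s * (J - (s * I + c * J))); first by ring.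
  by rewrite -eI -eJ !subrr !mulr0 subr0.
move/eqP: e0; rewrite mulf_eq0 => /orP[|/eqP //].
by rewrite paddr_eq0 ?sqr_ge0 // sqrf_eq0 subr_eq0 eq_sym (negbTE c1).
Qed.


Lemma pabs_loc n x y : ball_ n x -> ~ ball_ (n + 1) x ->
  ball_ (n + 1) (qsub y x) -> pabs R y = pabs R x.
Proof.
move=> hn hn1 hyx; rewrite (pabs_shell hn hn1); apply: pabs_shell.
  rewrite -(qadd_subK x y); apply: ballD => //; apply: ballW hyx; lia.
move=> hy; apply: hn1; rewrite -(qsubx0 x).
apply/(ball_sub_trans (zeroQ p) (ball_sub_sym hyx)).
by rewrite qsubx0.
Qed.

Lemma measurable_pabs : measurable_fun setT (@pabs R p : QpM R p -> R).
Proof.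
apply: measurable_loc_cst => x /shell_ex[n [hn hn1]]; exists (n + 1) => y.
exact: pabs_loc.
Qed.

(** * Radial integrals and the heat kernel *)

Definition shell n : set (QpM R p) := ball_ n `\` ball_ (n + 1).

Lemma pabs_on_shell n x : shell n x -> pabs R x = pR ^ (- n).
Proof. by move=> [h1 h2]; exact: pabs_shell. Qed.

Lemma measurable_shell n : measurable (shell n).
Proof. by apply: measurableD; exact: measurable_ball. Qed.

Lemma ball_shell n : ball_ n = shell n `|` ball_ (n + 1) :> set (QpM R p).
Proof.
rewrite /shell setUC setDUK // => x h; apply: (@ballW (n + 1)) => //; lia.
Qed.

Lemma shell_disj n : [disjoint shell n & ball_ (n + 1)].
Proof. by apply/disj_set2P/seteqP; split => // x [[_ h] h']. Qed.

Lemma Rintegral_ball_split n (f : QpM R p -> R) :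
  mu.-integrable (ball_ n) (EFin \o f) ->
  Rintegral mu (ball_ n) f = Rintegral mu (shell n) f + Rintegral mu (ball_ (n + 1)) f.
Proof.
move=> h; rewrite -Rintegral_setU; first by rewrite -ball_shell.
- exact: measurable_shell.
- exact: measurable_ball.
- by rewrite -ball_shell.
- exact: shell_disj.
Qed.

(** The outermost sphere is peeled off: the radial factor is constant there, and the integral of
    [phi] over it is a difference of two ball integrals. It serves with [phi] equal to 1 and to the
    character. *)
Lemma Rintegral_radial n (phi : QpM R p -> R) (h : R -> R) (M N : R) :
  measurable_fun setT phi -> (forall x, `|phi x| <= N) ->
  measurable_fun setT h -> (forall x, ball_ n x -> `|h (pabs R x)| <= M) ->
  Rintegral mu (ball_ n) (fun x => phi x * h (pabs R x)) =
  h (pR ^ (- n)) * (Rintegral mu (ball_ n) phi - Rintegral mu (ball_ (n + 1)) phi)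
  + Rintegral mu (ball_ (n + 1)) (fun x => phi x * h (pabs R x)).
Proof.
move=> mphi bphi mh bh.
have iphi k : mu.-integrable (ball_ k) (EFin \o phi).
  by apply: (@integrable_ball _ _ N) => // x _.
rewrite Rintegral_ball_split; last first.
  apply: (@integrable_ball _ _ (N * M)).
    apply: measurable_funM => //; apply: measurableT_comp => //; exact: measurable_pabs.
  by move=> x hx; rewrite normrM ler_pM // bh.
congr (_ + _); rewrite [in RHS](Rintegral_ball_split (iphi n)) addrK -RintegralZl.
- apply: eq_Rintegral => x; rewrite inE => hx.
  by rewrite (pabs_on_shell hx) mulrC.
- exact: measurable_shell.
- apply: integrableS (iphi n); [exact: measurable_ball|exact: measurable_shell|].
  by move=> x [].
Qed.

Lemma Rintegral_ball1 n : Rintegral mu (ball_ n) (cst 1) = pR ^ (- n).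
Proof. by rewrite Rintegral_cst ?mul1r ?mu_ball //; exact: measurable_ball. Qed.

Lemma Rintegral_ball_radial n (h : R -> R) (M : R) :
  measurable_fun setT h -> (forall x, ball_ n x -> `|h (pabs R x)| <= M) ->
  Rintegral mu (ball_ n) (fun x => h (pabs R x)) =
  h (pR ^ (- n)) * (pR ^ (- n) - pR ^ (- n - 1))
  + Rintegral mu (ball_ (n + 1)) (fun x => h (pabs R x)).
Proof.
move=> mh bh; have := @Rintegral_radial n (cst 1) h M 1.
rewrite !Rintegral_ball1 opprD.
have e k : Rintegral mu (ball_ k) (fun x => (cst 1 x : R) * h (pabs R x)) =
           Rintegral mu (ball_ k) (fun x => h (pabs R x)).
  by apply: eq_Rintegral => x _; rewrite mul1r.
by rewrite !e; apply => // x; rewrite normr1.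
Qed.

Variable b : R.
Hypothesis b_gt0 : 0 < b.

Let gr (c r : R) : R := expR (- (c * (r `^ b))).
(** With c = sigma t this is the Fourier transform of the heat kernel at time t. *)
Definition gau (c : R) (y : QpM R p) : R := gr c (pabs R y).

Lemma measurable_gr c : measurable_fun setT (gr c).
Proof.
apply: measurableT_comp; first exact: measurable_expR.
apply: measurableT_comp => //; apply: measurable_funM; first exact: measurable_cst.
exact: measurable_powR.
Qed.

Lemma measurable_gau c : measurable_fun setT (gau c).
Proof. exact: measurableT_comp (measurable_gr c) measurable_pabs. Qed.

Lemma gau_gt0 c y : 0 < gau c y. Proof. exact: expR_gt0. Qed.

Lemma gau_le1 c y : 0 <= c -> gau c y <= 1.
Proof. by move=> c0; rewrite -expR0 ler_expR oppr_le0 mulr_ge0 ?powR_ge0. Qed.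

Lemma gau_norm c y : 0 <= c -> `|gau c y| <= 1.
Proof. by move=> c0; rewrite ger0_norm ?gau_le1 // ltW ?gau_gt0. Qed.

Lemma integrable_gau_ball c n : 0 <= c -> mu.-integrable (ball_ n) (EFin \o gau c).
Proof.
move=> c0; apply: (@integrable_ball _ _ 1); first exact: measurable_gau.
by move=> x _; exact: gau_norm.
Qed.

(** Of the two factors p^(-j), one absorbs the mass of the ball of radius p^j and the other leaves a
    summable geometric series. The bound comes from exp(x) >= x^k / k! with k large enough that bk
    >= 2. *)
Lemma gr_decay c : 0 < c -> exists2 C : R, 0 <= C &
  forall j : nat, gr c (pR ^ j%:Z) <= C * pR ^ (- j%:Z) * pR ^ (- j%:Z).
Proof.
move=> c0; pose m := Num.truncn (2 / b); pose k := m.+1.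
have kb : 2 <= b * k%:R.
  by rewrite mulrC -ler_pdivrMr //; apply: ltW; exact: truncnS_gt.
have ck : 0 < c ^+ k by exact: exprn_gt0.
exists (k`!%:R / c ^+ k); first by rewrite divr_ge0 ?ler0n ?ltW.
move=> j; rewrite /gr expRN.
set x := c * _; have x0 : 0 <= x by rewrite mulr_ge0 ?powR_ge0 ?ltW.
have pj : 0 < pR ^ j%:Z := pRX_gt0 _.
have hx : c ^+ k * (pR ^ j%:Z) ^+ 2 <= x ^+ k.
  rewrite exprMn ler_wpM2l ?(ltW ck) //.
  rewrite -(@powR_mulrn _ _ k) ?powR_ge0 // -powRrM.
  rewrite -powR_mulrn ?(ltW pj) // ler_powR //.
  by rewrite -(expr0z pR) ler_eXz2l ?pR_gt1.
have := expR_ge1Dxn m x0; rewrite -/k => h.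
have {}h : c ^+ k * (pR ^ j%:Z) ^+ 2 / k`!%:R <= expR x.
  have i0 : 0 <= (k`!%:R : R)^-1 by rewrite invr_ge0 ler0n.
  by apply: le_trans (ler_wpM2r i0 hx) _; apply: le_trans h; rewrite lerDr.
have f0 : 0 < k`!%:R :> R by rewrite ltr0n fact_gt0.
rewrite -invr_expz; move: h pj; set y := pR ^ j%:Z => h pj.
have -> : k`!%:R / c ^+ k * y^-1 * y^-1 = (c ^+ k * y ^+ 2 / k`!%:R)^-1.
  by field; rewrite !gt_eqF.
by rewrite lef_pV2 ?posrE ?expR_gt0 // divr_gt0 // mulr_gt0 // exprn_gt0.
Qed.

Lemma ball_cover (x : Qp p) : exists j : nat, ball_ (- j%:Z) x.
Proof. by exists `|qlow x|%N; apply: (@ballW (qlow x)) (ball_qlow x); lia. Qed.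

Lemma bigcup_ball : \bigcup_(j : nat) (ball_ (- j%:Z) : set (QpM R p)) = setT.
Proof.
by apply/seteqP; split => // x _; have [j hj] := ball_cover x; exists j.
Qed.

Lemma ball_nondecreasing :
  nondecreasing_seq (fun j : nat => ball_ (- j%:Z) : set (QpM R p)).
Proof. by move=> i j ij; rewrite subsetEset => x; apply: ballW; lia. Qed.

Lemma cvg_integral_gau c : 0 < c ->
  (\int[mu]_(y in ball_ (- j%:Z)) (gau c y)%:E)%E @[j --> \oo] -->
  (\int[mu]_y (gau c y)%:E)%E.
Proof.
move=> c0; rewrite -bigcup_ball; apply: ge0_nondecreasing_set_cvg_integral.
- exact: ball_nondecreasing.
- by move=> j; exact: measurable_ball.
- by move=> j; apply/measurable_EFinP; apply: measurable_funTS; exact: measurable_gau.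
- by move=> j x _; rewrite lee_fin ltW ?gau_gt0.
Qed.

Lemma fin_integral_gau c n : 0 <= c ->
  (\int[mu]_(y in ball_ n) (gau c y)%:E)%E = (Rintegral mu (ball_ n) (gau c))%:E.
Proof.
move=> c0; rewrite /Rintegral fineK //.
by apply: integrable_fin_num; [exact: measurable_ball|exact: integrable_gau_ball].
Qed.

Lemma integrable_gau c : 0 < c -> mu.-integrable setT (EFin \o gau c).
Proof.
move=> c0; apply/integrableP; split.
  by apply/measurable_EFinP; exact: measurable_gau.
have [C C0 hC] := gr_decay c0.
pose G (j : nat) := Rintegral mu (ball_ (- j%:Z)) (gau c).
(* The bound telescopes: the sphere of radius p^(j+1) contributes at most C p^(-(j+1)), which is at
   most C (p^(-j) - p^(-(j+1))) since p >= 2. *)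
have hG j : G j <= G 0%N + C * (1 - pR ^ (- j%:Z)).
  elim: j => [|j IH]; first by rewrite oppr0 expr0z subrr mulr0 addr0.
  rewrite {1}/G (@Rintegral_ball_radial _ (gr c) 1); last 2 first.
  - exact: measurable_gr.
  - by move=> x _; apply: gau_norm; exact: ltW.
  rewrite (_ : - j.+1%:Z + 1 = - j%:Z); last by lia.
  rewrite opprK -/(G j).
  have e1 : pR ^ (- j%:Z) = pR * pR ^ (- j.+1%:Z).
    by rewrite -[X in X * _]expr1z -pRXD; congr (_ ^ _); lia.
  have p1 := pRX_gt0 (- j.+1%:Z); have p2 := pRX_gt0 j.+1%:Z; have p3 := pRX_gt0 (j.+1%:Z - 1).
  have e2 : pR ^ (- j.+1%:Z) * pR ^ j.+1%:Z = 1 by rewrite -pRXD addNr expr0z.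
  have g1 : gr c (pR ^ j.+1%:Z) * (pR ^ j.+1%:Z - pR ^ (j.+1%:Z - 1)) <= C * pR ^ (- j.+1%:Z).
    apply: (@le_trans _ _ (gr c (pR ^ j.+1%:Z) * pR ^ j.+1%:Z)).
      by apply: ler_wpM2l; [exact: expR_ge0|lra].
    apply: le_trans (ler_wpM2r (ltW p2) (hC j.+1)) _.
    by rewrite /= -[X in X <= _]mulrA e2 mulr1.
  have p_ge2 : 2 <= pR by rewrite ler_nat prime_gt1.
  have h2 : 2 * pR ^ (- j.+1%:Z) <= pR ^ (- j%:Z) by rewrite e1 ler_wpM2r // ltW.
  have /= := ler_wpM2l C0 h2; move: IH g1.
  lra.
apply: (@le_lt_trans _ _ ((G 0%N + C)%:E)); last exact: ltry.
under eq_integral do rewrite /= gtr0_norm ?gau_gt0 //.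
apply: (cvge_le _ (cvg_integral_gau c0)) => //.
near=> j; rewrite fin_integral_gau ?(ltW c0) // lee_fin; apply: le_trans (hG j) _.
by rewrite lerD2l ler_piMr // lerBlDr lerDl ltW // pRX_gt0.
Unshelve. all: end_near. Qed.


Lemma indic_iff T (A : set T) (u v : T) : (A u <-> A v) -> \1_A u = \1_A v :> R.
Proof. by move=> h; rewrite !indicE; congr (_%:R); congr (nat_of_bool _); apply/idP/idP; rewrite !inE => /h. Qed.

(** * Integrals of the heat kernel over a ball *)

Section Kernel.
Variable c : R.
Hypothesis c_gt0 : 0 < c.

Let gtot : R := Rintegral mu setT (gau c).

Lemma gau_tail eps : 0 < eps ->
  \forall j \near \oo, gtot - Rintegral mu (ball_ (- j%:Z)) (gau c) <= eps.
Proof.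
move=> e0; have fin : (\int[mu]_y (gau c y)%:E)%E \is a fin_num.
  by apply: integrable_fin_num => //; exact: integrable_gau.
have := cvg_integral_gau c_gt0; rewrite -(fineK fin) => /fine_cvg /cvgrPdist_le /(_ _ e0).
by apply: filterS => j; apply: le_trans; exact: ler_norm.
Qed.

(** The set [A] restricts the frequencies; [A = setT] gives the heat kernel, with c = sigma t. *)
Definition kern (A : set (QpM R p)) x : R := Rintegral mu A (fun y => re_chi x y * gau c y).

Lemma measurable_re_chi_gau x : measurable_fun setT (fun y : QpM R p => re_chi x y * gau c y).
Proof. by apply: measurable_funM; [exact: measurable_re_chi|exact: measurable_gau]. Qed.

Lemma re_chi_gau_le x y : `|re_chi x y * gau c y| <= gau c y.
Proof. by rewrite normrM (gtr0_norm (gau_gt0 _ _)) ler_piMl ?re_chi_le1 // ltW ?gau_gt0. Qed.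

Lemma integrable_re_chi_gau (A : set (QpM R p)) x : measurable A ->
  mu.-integrable A (EFin \o (fun y => re_chi x y * gau c y)).
Proof.
move=> mA; have iA := integrableS measurableT mA (@subsetT _ A) (integrable_gau c_gt0).
apply: le_integrable iA => //.
  by apply/measurable_EFinP; apply: measurable_funTS; exact: measurable_re_chi_gau.
move=> y _; rewrite /= lee_fin; apply: le_trans (re_chi_gau_le x y) _; exact: ler_norm.
Qed.

(* The truncation error is uniform in x, which replaces Fubini's theorem when
   the kernel is integrated over a ball. *)
Lemma kern_tail k x :
  `|kern setT x - kern (ball_ k) x| <= gtot - Rintegral mu (ball_ k) (gau c).
Proof.
have mb := measurable_ball k; have mc := measurableC mb.
have iA := integrableS measurableT mc (@subsetT _ _) (integrable_gau c_gt0).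
have dis : [disjoint (ball_ k : set (QpM R p)) & ~` ball_ k].
  by apply/disj_set2P; exact: setICr.
have spl (f : QpM R p -> R) : mu.-integrable setT (EFin \o f) ->
    Rintegral mu setT f = Rintegral mu (ball_ k) f + Rintegral mu (~` ball_ k) f.
  by move=> h; rewrite -Rintegral_setU ?setUv.
rewrite /kern spl; last exact: integrable_re_chi_gau.
rewrite /gtot spl; last exact: integrable_gau.
rewrite !(addrC (Rintegral mu (ball_ k) _)) !addrK.
apply: le_trans (le_normr_Rintegral mc (integrable_re_chi_gau x mc)) _.
apply: le_Rintegral => //; last by move=> y _; exact: re_chi_gau_le.
apply: le_integrable iA => //; last by move=> y _; rewrite /= !lee_fin normr_id; 
  apply: le_trans (re_chi_gau_le x y) _; exact: ler_norm.
apply/measurable_EFinP; apply: measurable_funTS.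
by apply: measurableT_comp => //; exact: measurable_re_chi_gau.
Qed.

(** Frequencies in p^k Z_p do not see translations by p^(-k) Z_p, so the truncated kernel is locally
    constant. *)
Lemma measurable_kern_ball k x0 :
  measurable_fun setT (fun x : QpM R p => kern (ball_ k) (qsub x x0)).
Proof.
apply: measurable_loc_cst => x _; exists (- k) => z hz.
have h (y : Qp p) : ball_ k y -> re_chi (qsub z x0) y = re_chi (qsub x x0) y.
  move=> hy; rewrite re_chiC (re_chiC (qsub x x0)).
  by apply: (re_chi_loc hy _).1; rewrite qsubBB.
rewrite /kern; apply: eq_Rintegral => y; rewrite inE => /h ->.
by [].
Qed.

Lemma measurable_kern x0 : measurable_fun setT (fun x : QpM R p => kern setT (qsub x x0)).
Proof.
apply: (@measurable_fun_cvg _ _ _ _ (fun j (x : QpM R p) => kern (ball_ (- j%:Z)) (qsub x x0))).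
  by move=> j; exact: measurable_kern_ball.
move=> x _; apply/cvgrPdist_le => e e0; have := gau_tail e0.
by apply: filterS => j; apply: le_trans; exact: kern_tail.
Qed.

Lemma kern_bnd (A : set (QpM R p)) x : measurable A -> `|kern A x| <= gtot.
Proof.
move=> mA; have iA := integrableS measurableT mA (@subsetT _ A) (integrable_gau c_gt0).
apply: le_trans (le_normr_Rintegral mA (integrable_re_chi_gau x mA)) _.
have in1 : mu.-integrable A (EFin \o (fun y => `|re_chi x y * gau c y|)).
  apply: le_integrable iA => //; last by move=> y _; rewrite /= !lee_fin normr_id;
    apply: le_trans (re_chi_gau_le x y) _; exact: ler_norm.
  apply/measurable_EFinP; apply: measurable_funTS.
  by apply: measurableT_comp => //; exact: measurable_re_chi_gau.
apply: (@le_trans _ _ (Rintegral mu A (gau c))).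
  by apply: le_Rintegral => // y _; exact: re_chi_gau_le.
rewrite /gtot -lee_fin /Rintegral !fineK.
- apply: ge0_subset_integral => //.
    by apply/measurable_EFinP; exact: measurable_gau.
  by move=> y _; rewrite lee_fin ltW ?gau_gt0.
- by apply: integrable_fin_num => //; exact: integrable_gau.
- exact: integrable_fin_num.
Qed.

(** The Fourier transform of the indicator of a ball is its mass times the indicator of the dual
    ball, so each frequency sphere contributes a difference of two such terms. *)
Lemma kern_rec k x : kern (ball_ k) x =
  gr c (pR ^ (- k)) * (pR ^ (- k) * \1_(ball_ (- k)) x
                       - pR ^ (- k - 1) * \1_(ball_ (- k - 1)) x)
  + kern (ball_ (k + 1)) x.
Proof.
have ri j : Rintegral mu (ball_ j) (re_chi x) = pR ^ (- j) * \1_(ball_ (- j)) x.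
  rewrite -[in LHS](opprK j) Rintegral_re_chi indicE; case: pselect => h.
    by rewrite mem_set // mulr1.
  by rewrite memNset // mulr0.
rewrite /kern (@Rintegral_radial k (re_chi x) (gr c) 1 1).
- by rewrite !ri opprD.
- exact: measurable_re_chi.
- exact: re_chi_le1.
- exact: measurable_gr.
- by move=> y _; apply: gau_norm; exact: ltW.
Qed.

Lemma Rintegral_indic_coset m j x0 : m <= j -> ball_ m x0 ->
  Rintegral mu (ball_ m) (fun x => \1_(ball_ j) (qsub x x0)) = pR ^ (- j).
Proof.
move=> mj hx0; rewrite /Rintegral.
transitivity (fine (\int[mu]_(x in ball_ m) (\1_(coset_ j x0) x)%:E)%E).
  by congr fine; apply: eq_integral => x _; rewrite !indicE.
rewrite integral_indic; [|exact: measurable_ball|exact: measurable_coset].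
rewrite setIidl ?fine_mu_coset // => x; rewrite /coset_ /= => h.
by apply/(ball_sub _ hx0); exact: ballW h.
Qed.

Lemma integrable_kern (A : set (QpM R p)) m x0 : measurable A ->
  measurable_fun setT (fun x : QpM R p => kern A (qsub x x0)) ->
  mu.-integrable (ball_ m) (EFin \o (fun x => kern A (qsub x x0))).
Proof.
by move=> mA mf; apply: (@integrable_ball _ _ gtot) => // x _; exact: kern_bnd.
Qed.

(** A mean value, since the dual ball p^(-m) Z_p has mass p^m. For c = sigma h it is the one-step
    probability of staying in p^m Z_p. *)
Definition ball_avg m : R := pR ^ (- m) * Rintegral mu (ball_ (- m)) (gau c).

(* For k < -m the contribution of the shell of index k vanishes because the
   two indicators of [kern_rec] have equal weighted mass in p^m Z_p. *)
Lemma Rintegral_kern_ball m k x0 : ball_ m x0 -> k <= - m ->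
  Rintegral mu (ball_ m) (fun x => kern (ball_ k) (qsub x x0)) = ball_avg m.
Proof.
move=> hx0 km; have [j ->] : exists j : nat, k = - m - j%:Z by exists `|- m - k|%N; lia.
elim: j {k km} => [|j IH].
  (* Base case: frequencies run over the dual ball, where the character equals 1, so the kernel is
     constant in x. *)
  rewrite subr0 (@eq_Rintegral _ _ _ mu _ (cst (Rintegral mu (ball_ (- m)) (gau c)))).
    by rewrite Rintegral_cst ?mu_ball 1?mulrC //; exact: measurable_ball.
  move=> x; rewrite inE => hx; apply: eq_Rintegral => y; rewrite inE => hy.
  by rewrite (re_chi_unit (ballB hx hx0) hy).1 mul1r.
set k := - m - j.+1%:Z; have k1 : k + 1 = - m - j%:Z by rewrite /k; lia.
rewrite -IH -k1.
have mi i : measurable_fun setT (fun x : QpM R p => \1_(ball_ i) (qsub x x0) : R).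
  apply: measurable_loc_cst => x _; exists i => y yx.
  exact: indic_iff (ball_sub_trans x0 yx).
have ii (a : R) i : mu.-integrable (ball_ m) (EFin \o (fun x => a * \1_(ball_ i) (qsub x x0))).
  apply: (@integrable_ball _ _ `|a|).
    by apply: measurable_funM => //; exact: measurable_cst.
  by move=> x _; rewrite normrM ler_piMr // indicE; case: (_ \in _); rewrite ?normr1 ?normr0.
have ii1 i : mu.-integrable (ball_ m) (EFin \o (fun x => \1_(ball_ i) (qsub x x0))).
  have := ii 1 i; apply: eq_integrable; first exact: measurable_ball.
  by move=> x _ /=; rewrite mul1r.
have mb := measurable_ball m.
have ik i : mu.-integrable (ball_ m) (EFin \o (fun x => kern (ball_ i) (qsub x x0))).
  by apply: integrable_kern; [exact: measurable_ball|exact: measurable_kern_ball].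
pose s (x : QpM R p) := pR ^ (- k) * \1_(ball_ (- k)) (qsub x x0)
                       - pR ^ (- k - 1) * \1_(ball_ (- k - 1)) (qsub x x0).
have is_ : mu.-integrable (ball_ m) (EFin \o s).
  by have := integrableB mb (ii (pR ^ (- k)) (- k)) (ii (pR ^ (- k - 1)) (- k - 1)).
rewrite (@eq_Rintegral _ _ _ mu _ (fun x => gr c (pR ^ (- k)) * s x + kern (ball_ (k + 1)) (qsub x x0))); last first.
  by move=> x _; rewrite kern_rec.
rewrite RintegralD //; last by have := integrableZl mb (gr c (pR ^ (- k))) is_.
rewrite RintegralZl // /s RintegralB // !RintegralZl //.
rewrite !Rintegral_indic_coset //; [|by rewrite /k; lia|by rewrite /k; lia].
by rewrite -!pRXD !subrr mulr0 add0r.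
Qed.

Lemma Rintegral_kern m x0 : ball_ m x0 ->
  Rintegral mu (ball_ m) (fun x => kern setT (qsub x x0)) = ball_avg m.
Proof.
move=> hx0; have mb := measurable_ball m.
have iT := integrable_kern m measurableT (measurable_kern x0).
apply/eqP; rewrite -subr_eq0 -normr_le0; apply/ler_addgt0Pr => e e0; rewrite add0r.
(* The factor [pR ^ m] cancels the mass p^(-m) of the ball over which the uniform error is
   integrated. *)
have e1 : 0 < e * pR ^ m by rewrite mulr_gt0 ?pRX_gt0.
have [N _ hN] := gau_tail e1.
(* Adding |m| ensures that the truncation ball contains the dual ball. *)
pose j := (N + `|m|)%N; have {}hN := hN j (leq_addr _ _).
rewrite -(@Rintegral_kern_ball m (- j%:Z) x0) //; last by rewrite /j; lia.
have ik := integrable_kern m (measurable_ball (- j%:Z)) (measurable_kern_ball (- j%:Z) x0).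
rewrite -RintegralB //.
have mB : measurable_fun setT (fun x : QpM R p =>
    kern setT (qsub x x0) - kern (ball_ (- j%:Z)) (qsub x x0)).
  by apply: measurable_funB; [exact: measurable_kern|exact: measurable_kern_ball].
have iB : mu.-integrable (ball_ m) (EFin \o (fun x =>
    kern setT (qsub x x0) - kern (ball_ (- j%:Z)) (qsub x x0))).
  by have := integrableB mb iT ik.
apply: le_trans (le_normr_Rintegral mb iB) _.
apply: (@le_trans _ _ (Rintegral mu (ball_ m) (cst (e * pR ^ m)))).
  apply: le_Rintegral => //.
  - apply: (@integrable_ball _ _ (gtot + gtot)); first exact: measurableT_comp.
    move=> x _; rewrite normr_id; apply: le_trans (ler_normB _ _) _.
    by apply: lerD; apply: kern_bnd => //; exact: measurable_ball.
  - apply: (@integrable_ball _ _ `|e * pR ^ m|) => //.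
  - move=> x _; apply: le_trans (kern_tail _ _) _; exact: hN.
by rewrite Rintegral_cst // mu_ball /= -mulrA -pRXD subrr expr0z mulr1.
Qed.

(** Here K stands for the value of the remaining inner integrals, which is constant on the ball. *)
Lemma integral_kern_cst m x0 (K : R) : ball_ m x0 ->
  (\int[mu]_(x in ball_ m) ((kern setT (qsub x x0))%:E * K%:E) = (ball_avg m * K)%:E)%E.
Proof.
move=> hx0; have iT := integrable_kern m measurableT (measurable_kern x0).
have mb := measurable_ball m.
rewrite (integralZr mb iT) EFinM -(Rintegral_kern hx0) /Rintegral fineK //.
exact: integrable_fin_num iT.
Qed.

End Kernel.


(** * Averages over the dual ball *)

Let B : R := pR `^ b.
Let kap : R := qalpha p b.

Lemma B_ge1 : 1 <= B.
Proof. by rewrite -(powRr0 pR) ler_powR ?ltW // ltr1n prime_gt1. Qed.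

Lemma B_gt0 : 0 < B. Proof. exact: lt_le_trans ltr01 B_ge1. Qed.

Lemma pB_gt1 : 1 < pR * B.
Proof.
by apply: lt_le_trans pR_gt1 _; rewrite ler_pMr ?pR_gt0 //; exact: B_ge1.
Qed.

Lemma powR_pX n : (pR ^ n) `^ b = B ^ n.
Proof.
have p0 := ltW pR_gt0.
by rewrite -(powR_intmul n p0) powRAC powR_intmul // powR_ge0.
Qed.

(** Division-free form of alpha; it is the relation that makes the sphere-by-sphere recursion for
    the integral of |y|^b close up. *)
Lemma qalphaE : kap * (pR * B - 1) = pR * B - B.
Proof.
have nz : pR * B - 1 != 0 by rewrite subr_eq0 gt_eqF // pB_gt1.
rewrite /kap /qalpha powRD; last by rewrite pR_neq0 implybT.
by rewrite powRr1 ?(ltW pR_gt0) // -/B (mulrC B); field.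
Qed.

Lemma powR_pabs_bnd n x : ball_ n x -> 0 <= pabs R x `^ b <= B ^ (- n).
Proof.
move=> /pabs_leP h; rewrite powR_ge0 /= -powR_pX.
by apply: (ge0_ler_powR (ltW b_gt0)) h; rewrite nnegrE ?pabs_ge0 // ltW ?pRX_gt0.
Qed.

Lemma measurable_pow_pabs : measurable_fun setT (fun x : QpM R p => pabs R x `^ b).
Proof. exact: measurableT_comp (measurable_powR b) measurable_pabs. Qed.

Lemma pow_pabs_norm n x : ball_ n x -> `|pabs R x `^ b| <= B ^ (- n).
Proof. by move=> /powR_pabs_bnd /andP[h0 h1]; rewrite ger0_norm. Qed.

Lemma integrable_pow_pabs n :
  mu.-integrable (ball_ n) (EFin \o (fun x => pabs R x `^ b)).
Proof.
by apply: (integrable_ball measurable_pow_pabs) => x; exact: pow_pabs_norm.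
Qed.

(* Both sides satisfy the same recursion in n, so their difference is constant
   in n; it tends to 0 as the ball shrinks. *)
Lemma Rintegral_pow_pabs n :
  Rintegral mu (ball_ n) (fun x => pabs R x `^ b) = kap * (pR * B) ^ (- n).
Proof.
pose J i := Rintegral mu (ball_ i) (fun x => pabs R x `^ b).
have w0 : pR * B != 0 by rewrite gt_eqF // (lt_trans ltr01 pB_gt1).
have wE i : (pR * B) ^ i = pR ^ i * B ^ i by rewrite exprzMl // unitfE ?pR_neq0 // gt_eqF ?B_gt0.
pose D i := J i - kap * (pR * B) ^ (- i).
have wS i : (pR * B) ^ (- i) = pR * B * (pR * B) ^ (- (i + 1)).
  by rewrite (_ : - i = 1 + - (i + 1)) ?expfzDr ?expr1z //; lia.
have DS i : D i = D (i + 1).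
  rewrite /D {1}/J (@Rintegral_ball_radial i (fun r => r `^ b) (B ^ (- i))); last 2 first.
  - exact: measurable_powR.
  - by move=> x; exact: pow_pabs_norm.
  rewrite powR_pX -/(J (i + 1)) mulrBr.
  have -> : B ^ (- i) * pR ^ (- i) = (pR * B) ^ (- i) by rewrite wE mulrC.
  have -> : B ^ (- i) * pR ^ (- i - 1) = B * (pR * B) ^ (- (i + 1)).
    rewrite wE mulrCA mulrC opprD (_ : B ^ (- i) = B * B ^ (- i - 1)) //.
    by rewrite [in LHS](_ : - i = 1 + (- i - 1)) ?expfzDr ?expr1z ?gt_eqF ?B_gt0 //; lia.
  rewrite wS; set W := _ ^ _; have := congr1 (fun r => r * W) qalphaE.
  by rewrite /=; lra.
have Dj i (j : nat) : D i = D (i + j%:Z).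
  elim: j => [|j IH]; first by rewrite addr0.
  by rewrite IH DS -addrA; congr (D (_ + _)); lia.
have Dbnd i : `|D i| <= (1 + `|kap|) * (pR * B) ^ (- i).
  have W0 : 0 < (pR * B) ^ (- i) by rewrite exprz_gt0 // (lt_trans ltr01 pB_gt1).
  apply: le_trans (ler_normB (J i) (kap * (pR * B) ^ (- i))) _.
  rewrite normrM (gtr0_norm W0) mulrDl mul1r lerD2r.
  have mb := measurable_ball i.
  rewrite ger0_norm; last by apply: Rintegral_ge0 => x _; exact: powR_ge0.
  apply: (@le_trans _ _ (Rintegral mu (ball_ i) (cst (B ^ (- i))))).
    apply: le_Rintegral => //; first exact: integrable_pow_pabs.
      by apply: (@integrable_ball _ _ `|B ^ (- i)|).
    by move=> x /powR_pabs_bnd /andP[].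
  by rewrite Rintegral_cst // mu_ball /= wE mulrC.
suff : `|D n| <= 0 by rewrite normr_le0 subr_eq0 => /eqP.
pose z := (pR * B)^-1.
have z1 : `|z| < 1.
  by rewrite ger0_norm ?invr_ge0 ?invf_lt1 ?pB_gt1 // ?ltW // (lt_trans ltr01 pB_gt1).
apply: (cvgr_to_ge (@cvg_geometric R ((1 + `|kap|) * (pR * B) ^ (- n)) z z1)).
near=> j; rewrite (Dj n j); apply: le_trans (Dbnd _) _.
rewrite /geometric /= -mulrA opprD expfzDr // /z exprVn -exprnN.
by rewrite -exprz_inv.
Unshelve. all: end_near. Qed.

(** * Second-order bounds and the dyadic limit *)

Lemma expRN_le (u : R) : 0 <= u -> expR (- u) <= 1 - u + u ^+ 2.
Proof.
move=> u0; have h : 0 < 1 + u by lra.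
rewrite expRN; apply: (@le_trans _ _ (1 + u)^-1).
  by rewrite lef_pV2 ?posrE ?expR_gt0 // expR_ge1Dx.
rewrite -div1r ler_pdivrMr // -subr_ge0.
have -> : (1 - u + u ^+ 2) * (1 + u) - 1 = u ^+ 3 by ring.
exact: exprn_ge0.
Qed.

Lemma ball_avg_bounds c m : 0 <= c ->
  1 - c * (kap * B ^ m) <= ball_avg c m <= 1 - c * (kap * B ^ m) + (c * B ^ m) ^+ 2.
Proof.
move=> c0; have mb := measurable_ball (- m).
have ip := integrable_pow_pabs (- m).
have pm := pRX_gt0 m; have pm' := pRX_gt0 (- m).
have pp : pR ^ (- m) * pR ^ m = 1 by rewrite -pRXD addNr expr0z.
(* Both bounds belong to this family: K = 1 below, and K = 1 + (c B^m)^2 above, because c |y|^b <= c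
   B^m on the dual ball. *)
pose f (K : R) (y : QpM R p) : R := K - c * (pabs R y `^ b).
have icst (K : R) : mu.-integrable (ball_ (- m)) (EFin \o (cst K : QpM R p -> R)).
  exact: (@integrable_ball _ _ `|K|).
have icp : mu.-integrable (ball_ (- m)) (EFin \o (fun y => c * pabs R y `^ b)).
  by have := integrableZl mb c ip.
have if_ K : mu.-integrable (ball_ (- m)) (EFin \o f K).
  by have := integrableB mb (icst K) icp.
have intf K : pR ^ (- m) * Rintegral mu (ball_ (- m)) (f K) = K - c * (kap * B ^ m).
  have -> : Rintegral mu (ball_ (- m)) (f K) = K * pR ^ m - c * (kap * (pR * B) ^ m).
    rewrite [LHS](RintegralB mb (icst K) icp) (RintegralZl c mb ip).
    by rewrite Rintegral_cst // Rintegral_pow_pabs mu_ball /= opprK.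
  rewrite exprzMl ?unitfE ?pR_neq0 ?gt_eqF ?B_gt0 //.
  have -> : forall r s k d e h : R,
      r * (k * s - d * (e * (s * h))) = (r * s) * (k - d * (e * h)).
    by move=> *; ring.
  by rewrite pp mul1r.
rewrite /ball_avg -(intf 1).
have -> : pR ^ (- m) * Rintegral mu (ball_ (- m)) (f 1) + (c * B ^ m) ^+ 2 =
   pR ^ (- m) * Rintegral mu (ball_ (- m)) (f (1 + (c * B ^ m) ^+ 2)).
  by rewrite !intf; ring.
have ig := integrable_gau_ball (- m) c0.
rewrite !ler_pM2l //; apply/andP; split.
  by apply: (le_Rintegral mb (if_ _) ig) => y _; exact: expR_ge1Dx.
apply: (le_Rintegral mb ig (if_ _)) => y hy.
have /andP[h0 h1] := powR_pabs_bnd hy; rewrite opprK in h1.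
have hc : 0 <= c * pabs R y `^ b by exact: mulr_ge0.
apply: le_trans (expRN_le hc) _; rewrite /f.
have h2 : (c * pabs R y `^ b) ^+ 2 <= (c * B ^ m) ^+ 2.
  by apply: lerXn2r; rewrite ?nnegrE ?mulr_ge0 ?ler_wpM2l // (le_trans h0 h1).
by lra.
Qed.

(** A squeeze that uses only 1 + x <= exp(x): directly for the upper bound, and for the lower one as
    1/(1 - v) = 1 + v/(1 - v) <= exp(v/(1 - v)) with v = l 2^(-n). Raising to the power 2^n cancels
    one factor 2^(-n) in the exponents. *)
Lemma cvg_exp_dyadic (l K : R) (u : nat -> R) : 0 <= l ->
  (forall n : nat, 1 - l * (2^-1) ^+ n <= u n <= 1 - l * (2^-1) ^+ n + K * ((2^-1) ^+ n) ^+ 2) ->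
  (fun n : nat => u n ^+ (2 ^ n)) @ \oo --> expR (- l).
Proof.
move=> l0 hu; pose e (n : nat) : R := (2^-1) ^+ n.
have ce : e @ \oo --> (0 : R).
  by apply: cvg_expr; rewrite ger0_norm ?invf_lt1 ?ltr1n // invr_ge0.
have eN (n : nat) : e n * (2 ^ n)%:R = 1.
  by rewrite /e natrX -exprMn mulVf ?expr1n.
have cl : (1 - l * e n) @[n --> \oo] --> (1 : R).
  rewrite -[X in _ --> X]subr0 -[X in _ --> _ - X](mulr0 l).
  by apply: cvgB; [exact: cvg_cst|apply: cvgM => //; exact: cvg_cst].
have cexp (f : nat -> R) (x : R) : f @ \oo --> x -> (expR (f n)) @[n --> \oo] --> expR x.
  by move=> h; apply: (cvg_comp _ _ h); exact: continuous_expR.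
pose lo (j : nat) : R := expR (- (l / (1 - l * e j))).
pose hi (j : nat) : R := expR (- l + K * e j).
apply: (@squeeze_cvgr _ _ _ _ lo hi); rewrite /lo /hi.
- near=> n.
  have d0 : 0 < 1 - l * e n by near: n; exact: (cvgr_gt _ cl).
  have /andP[h1 h2] := hu n; rewrite -/(e n) in h1 h2; apply/andP; split.
    have -> : - (l / (1 - l * e n)) = (- (l * e n / (1 - l * e n))) * (2 ^ n)%:R.
      by rewrite mulNr (mulrAC (l * e n)) -(mulrA l) eN mulr1.
    rewrite expRM_natr; apply: lerXn2r; rewrite ?nnegrE ?expR_ge0 //.
      exact: le_trans (ltW d0) h1.
    apply: le_trans h1; rewrite expRN invf_ple ?posrE ?expR_gt0 //.
    apply: le_trans (expR_ge1Dx _).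
    rewrite le_eqVlt; apply/orP; left; apply/eqP.
    by field; rewrite gt_eqF.
  have -> : - l + K * e n = (- l * e n + K * e n ^+ 2) * (2 ^ n)%:R.
    have -> : forall r : R, (- l * e n + K * e n ^+ 2) * r = - l * (e n * r) + K * e n * (e n * r).
      by move=> r; ring.
    by rewrite eN !mulr1.
  rewrite expRM_natr; apply: lerXn2r; rewrite ?nnegrE ?expR_ge0 //.
    exact: le_trans (ltW d0) h1.
  apply: le_trans h2 _; rewrite -addrA -mulNr; exact: expR_ge1Dx.
- rewrite (_ : - l = - (l * 1^-1)); last by rewrite invr1 mulr1.
  apply: cexp; apply: cvgN; apply: cvgM; first exact: cvg_cst.
  by apply: cvgV => //; exact: oner_neq0.
- rewrite (_ : expR (- l) = expR (- l + K * 0)); last by rewrite mulr0 addr0.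
  apply: cexp; apply: cvgD; first exact: cvg_cst.
  by apply: cvgM => //; exact: cvg_cst.
Unshelve. all: end_near. Qed.


Lemma qalpha_ge0 : 0 <= kap.
Proof.
have h : 0 < pR * B - 1 by rewrite subr_gt0 pB_gt1.
rewrite -(pmulr_lge0 _ h) qalphaE subr_ge0 ler_pMl ?B_gt0 //; exact: ltW pR_gt1.
Qed.

(** * Paths *)

(** Right continuity controls times from t on, the left limit controls earlier ones, and one ball
    contains both limiting values. At t = 0 only the right side matters. *)
Lemma ball_path_locally_bounded (w : Dpath R p) (t : R) : 0 <= t ->
  exists n (d : R), 0 < d /\ forall s, `|s - t| < d -> 0 <= s -> ball_ n (w s).
Proof.
move=> t0; have [hr hl] := dpath_cadlag w t0.
have near_ball n (v u : Qp p) : ball_ n v -> pabs R (qsub u v) < pR ^ (- n) -> ball_ n u.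
  move=> hv /ltW /pabs_leP h; rewrite -(qsubx0 u).
  by apply/(ball_sub_trans (zeroQ p) h); rewrite qsubx0.
case: (ltgtP t 0) t0 => // [t_gt0|t_eq0] _.
  have [l hl'] := hl t_gt0; pose n := Num.min (qlow (w t)) (qlow l).
  have [d1 [d10 h1]] := hr _ (pRX_gt0 (- n)); have [d2 [d20 h2]] := hl' _ (pRX_gt0 (- n)).
  exists n, (Num.min d1 d2); split; first by rewrite lt_min d10.
  move=> s; rewrite lt_min => /andP[]; rewrite !ltr_norml => /andP[a1 a2] /andP[a3 a4] _.
  have [ts|st] := leP t s.
    apply: (near_ball n (w t)); first by apply: ballW (ball_qlow _); rewrite /n ge_min lexx.
    by apply: h1 => //; lra.
  apply: (near_ball n l); first by apply: ballW (ball_qlow _); rewrite /n ge_min lexx orbT.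
  by apply: h2 => //; lra.
have [d1 [d10 h1]] := hr _ (pRX_gt0 (- qlow (w t))).
exists (qlow (w t)), d1; split => // s; rewrite ltr_norml => /andP[_ a2] s0.
apply: near_ball (ball_qlow (w t)) _; apply: h1; first by rewrite t_eq0.
by lra.
Qed.

(** A bound on [sup] says something about each time only if the set of values is bounded above; this
    follows from local boundedness and compactness of [0, T]. *)
Lemma normT_leP (w : Dpath R p) (T : R) m : 0 <= T ->
  normT w T <= pR ^ (- m) <-> forall t, 0 <= t -> t <= T -> ball_ m (w t).
Proof.
move=> T0; split=> [h t t0 tT|h]; last first.
  apply: ge_sup; first by exists (pabs R (w 0)); exists 0 => //=; rewrite in_itv /= lexx.
  move=> _ [t /= ht <-]; apply/pabs_leP; move: ht; rewrite in_itv /= => /andP[t0 tT].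
  exact: h.
apply/pabs_leP; apply: le_trans h; apply: ub_le_sup; last first.
  by exists t => //=; rewrite in_itv /= t0.
have /compact_near_coveringP cov : compact `[0, T]%classic := @segment_compact R 0 T.
have := cov R (pinfty_nbhs R) (fun M s => 0 <= s -> pabs R (w s) <= M) _ _.
move=> [] //.
  move=> s; rewrite /= in_itv /= => /andP[s0 _].
  have [n [d [d0 hd]]] := ball_path_locally_bounded w s0.
  exists ([set r | `|r - s| < d], [set M | pR ^ (- n) <= M]).
    split => /=.
      by apply/nbhs_ballP; exists d => // r; rewrite /ball /= distrC.
    by apply: nbhs_pinfty_ge; exact: num_real.
  move=> [r M] /= [hr hM] r0; apply: le_trans hM; apply/pabs_leP; exact: hd.
move=> M [_ hM]; exists (M + 1) => _ [s /= hs <-].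
have := hM (M + 1); rewrite ltrDl ltr01 => /(_ isT s hs); apply.
by move: hs; rewrite in_itv /= => /andP[].
Qed.

(** * Dyadic grids and the law of the maximum *)

Variable sigma : R.
Hypothesis sigma_gt0 : 0 < sigma.

Lemma rhoE t x : rho mu b sigma t x = kern (sigma * t) setT x.
Proof. by rewrite /rho /kern; apply: eq_Rintegral. Qed.

(** The start (t, x0) is arbitrary so that induction applies to the inner integrals, whose value
    does not depend on the point reached in the ball. *)
Lemma fdd_dens_ball m (h : R) (j : nat) (t : R) (x0 : Qp p) : 0 < h -> ball_ m x0 ->
  fdd_dens mu b sigma (zip (traject (fun s => s + h) (t + h) j) (nseq j (ball_ m))) t x0
  = (ball_avg (sigma * h) m ^+ j)%:E.
Proof.
move=> h0; elim: j t x0 => [//|j IH] t x0 hx0 /=.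
have c0 : 0 < sigma * h by exact: mulr_gt0.
rewrite exprS -(integral_kern_cst c0 _ hx0).
apply: eq_integral => x; rewrite inE => hx.
rewrite (IH (t + h) x hx) (addrC t h) addrK.
exact: (congr1 (fun r : R => (r%:E * _)%E) (rhoE h _)).
Qed.

Lemma path_traject (h : R) (j : nat) (t : R) : 0 < h ->
  path <%R t (traject (fun s => s + h) (t + h) j).
Proof. by move=> h0; elim: j t => //= j IH t; rewrite ltrDl h0 IH. Qed.

Lemma nth_traject_add (h t : R) (j i : nat) : (i < j)%N ->
  nth 0 (traject (fun s => s + h) (t + h) j) i = t + h * i.+1%:R.
Proof.
elim: j i t => [//|j IH] [|i] t hij /=; first by rewrite mulr1.
by rewrite IH // -[in RHS]natr1 mulrDr mulr1 addrAC addrA.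
Qed.

Variable P : probability (DM R p) R.
Hypothesis P_start : P [set w : DM R p | dpath w 0 = zeroQ p] = 1%E.
Hypothesis P_fdd : forall (ts : seq R) (Us : seq (set (QpM R p))),
  size ts = size Us -> path <%R 0 ts ->
  (forall i : nat, (i < size Us)%N -> measurable (nth set0 Us i)) ->
  P [set w : DM R p | forall i : nat, (i < size ts)%N ->
                        nth set0 Us i (dpath w (nth 0 ts i))]
  = fdd_dens mu b sigma (zip ts Us) 0 (zeroQ p).

Lemma measurable_coord (t : R) m : measurable ([set w : Dpath R p | ball_ m (w t)] : set (DM R p)).
Proof.
apply: sub_sigma_algebra; exists t, (ball_ m); split=> //; exact: measurable_ball.
Qed.

Lemma normT_law_dyadic m (T : R) (N : nat) : 0 < T ->
  P [set w : Dpath R p | forall i : nat, (i < 2 ^ N)%N -> ball_ m (w (T / 2 ^+ N * i.+1%:R))]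
  = (ball_avg (sigma * (T / 2 ^+ N)) m ^+ (2 ^ N))%:E.
Proof.
move=> T0; pose h := T / 2 ^+ N; have h0 : 0 < h by rewrite divr_gt0 // exprn_gt0.
rewrite -(fdd_dens_ball (2 ^ N) 0 h0 (ball_zero m)) -P_fdd.
- congr (P _); apply/seteqP; split => w /= H i.
    by rewrite size_traject => hi; rewrite nth_nseq hi nth_traject_add // add0r; exact: H.
  move=> hi; have := H i; rewrite size_traject => /(_ hi).
  by rewrite nth_nseq hi nth_traject_add // add0r.
- by rewrite size_traject size_nseq.
- by have := path_traject (2 ^ N) 0 h0.
- by move=> i; rewrite size_nseq nth_nseq => ->; exact: measurable_ball.
Qed.

(** Right continuity compares w(t) only with later times, so the grid point must lie in [t, t + d);
    the mesh is below d because 2^N > N > T/d. *)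
Lemma dyadic_approx (T t d : R) : 0 <= t -> t < T -> 0 < d ->
  exists N i : nat, [/\ (i < 2 ^ N)%N, t <= T / 2 ^+ N * i.+1%:R
                      & T / 2 ^+ N * i.+1%:R < t + d].
Proof.
move=> t0 tT d0; have T0 := le_lt_trans t0 tT.
pose N := (Num.truncn (T / d)).+1; pose h := T / 2 ^+ N.
have N0 : 0 < (2 : R) ^+ N by exact: exprn_gt0.
have h0 : 0 < h by exact: divr_gt0.
have hd : h < d.
  rewrite /h ltr_pdivrMr // mulrC -ltr_pdivrMr //.
  apply: lt_trans (truncnS_gt _) _; rewrite -/N -natrX ltr_nat; exact: ltn_expl.
have th0 : 0 <= t / h by rewrite divr_ge0 // ltW.
have /andP[a1 a2] := truncn_itv th0.
exists N, (Num.truncn (t / h)); split.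
- rewrite -(ltr_nat R) natrX; apply: le_lt_trans a1 _.
  by rewrite ltr_pdivrMr // /h mulrC mulfVK // gt_eqF.
- by rewrite mulrC -ler_pdivrMr // ltW.
- rewrite -/h -natr1 mulrDr mulr1; move: a1; rewrite ler_pdivlMr // mulrC; lra.
Qed.

Lemma normT_bigcap m (T : R) : 0 < T ->
  [set w : Dpath R p | normT w T <= pR ^ (- m)] =
  \bigcap_(N : nat) [set w : Dpath R p | forall i : nat, (i < 2 ^ N)%N ->
                       ball_ m (w (T / 2 ^+ N * i.+1%:R))].
Proof.
move=> T0; apply/seteqP; split => w.
  move=> /(normT_leP _ _ (ltW T0)) h N _ i hi; have N0 : 0 < (2 : R) ^+ N by exact: exprn_gt0.
  apply: h; first by rewrite mulr_ge0 ?divr_ge0 ?ltW.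
  by rewrite mulrAC ler_pdivrMr // ler_pM2l // -natrX ler_nat.
move=> H; apply/(normT_leP _ _ (ltW T0)) => t t0; rewrite le_eqVlt => /orP[/eqP->|tT].
  (* The endpoint T has no grid time after it, but it is the only grid time of level 0. *)
  by have := H 0%N I 0%N isT; rewrite expr0 divr1 mulr1.
have [hr _] := dpath_cadlag w t0; have [d [d0 hd]] := hr _ (pRX_gt0 (- m)).
have [N [i [hi h1 h2]]] := dyadic_approx t0 tT d0.
have /ltW/pabs_leP hb := hd _ h1 h2.
have := H N I i hi; rewrite -(qsubx0 (w (T / _ * _))) => hs.
by rewrite -(qsubx0 (w t)); exact: (ball_sub_trans (zeroQ p) hb).1 hs.
Qed.

Lemma normT_law (T : R) (a : int) : 0 <= T ->
  P [set w : DM R p | normT w T <= pR ^ a]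
  = (expR (- (sigma * kap * T * (pR `^ (- (a%:~R * b))))))%:E.
Proof.
rewrite -[a in pR ^ a]opprK; set m := - a.
have Bm : pR `^ (- (a%:~R * b)) = B ^ m.
  rewrite -powR_intmul ?(ltW B_gt0) // /B -powRrM; congr (_ `^ _).
  by rewrite /m mulrNz mulrN mulrC.
rewrite Bm le_eqVlt => /orP[/eqP<-|T0].
  (* For T = 0 there is no grid; the event contains the almost sure event that the path starts at
     0. *)
  rewrite mulr0 mul0r oppr0 expR0.
  have -> : [set w : Dpath R p | normT w 0 <= pR ^ (- m)] = [set w : Dpath R p | ball_ m (w 0)].
    apply/seteqP; split => w; first by move=> /(normT_leP _ _ (lexx _)); exact.
    move=> h; apply/(normT_leP _ _ (lexx _)) => t t0 t0'.
    by have -> : t = 0 by apply/eqP; rewrite eq_le t0 t0'.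
  have mb := measurable_coord 0 m.
  apply/eqP; rewrite eq_le probability_le1 //= -P_start.
  apply: le_measure; rewrite ?inE //; last by move=> w /= ->; exact: ball_zero.
  apply: sub_sigma_algebra; exists 0, [set zeroQ p]; split => //.
  have -> : [set zeroQ p] = \bigcap_(j : nat) (ball_ j%:Z : set (QpM R p)).
    apply/seteqP; split => x; first by move=> -> j _; exact: ball_zero.
    move=> h; apply: ball_all_eq0 => n; apply: (@ballW `|n|%N); first by lia.
    exact: h.
  by apply: bigcapT_measurable => j; exact: measurable_ball.
pose E (N : nat) : set (DM R p) := [set w : Dpath R p | forall i : nat, (i < 2 ^ N)%N ->
                       ball_ m (w (T / 2 ^+ N * i.+1%:R))].
have mE N : measurable (E N).
  have -> : E N = \bigcap_(i : nat) (if (i < 2 ^ N)%N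
     then [set w : Dpath R p | ball_ m (w (T / 2 ^+ N * i.+1%:R))] else setT).
    apply/seteqP; split => w h i.
      by move=> _; case: ifP => // /h.
    by move=> hi; have := h i I; rewrite hi.
  apply: bigcapT_measurable => i; case: ifP => _ //; exact: measurable_coord.
have dE : {homo E : j k / (j <= k)%N >-> (k <= j)%O}.
  apply: homo_leq => // [A C D /[swap]|N]; first exact: le_trans.
  rewrite subsetEset => w h i hi.
  (* Grid times are numbered from 1, so time i + 1 of level N is time 2i + 2 of level N + 1, which
     has index 2i + 1. *)
  have := h i.*2.+1; rewrite expnS mul2n -doubleS leq_double => /(_ hi).
  rewrite (_ : T / 2 ^+ N.+1 * _ = T / 2 ^+ N * i.+1%:R) //.
  rewrite -muln2 natrM exprS; field; rewrite expf_neq0 ?pnatr_eq0 //.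
have c1 : P \o E @ \oo --> P (\bigcap_N E N).
  apply: nonincreasing_cvg_mu => //; last exact: bigcapT_measurable.
  exact: le_lt_trans (probability_le1 P (mE 0%N)) (ltry _).
rewrite (normT_bigcap m T0).
have l0 : 0 <= sigma * kap * T * B ^ m.
  by rewrite !mulr_ge0 ?qalpha_ge0 ?ltW // exprz_gt0 // B_gt0.
(* Continuity from above gives one limit of the grid probabilities; it remains to compute the same
   limit from their closed form. *)
apply: (cvg_unique _ c1) => //.
have -> : P \o E = EFin \o (fun N : nat => ball_avg (sigma * (T / 2 ^+ N)) m ^+ (2 ^ N)).
  by apply: funext => N /=; rewrite -normT_law_dyadic.
apply: cvg_EFin; first by near=> N.
apply: (@cvg_exp_dyadic _ ((sigma * T * B ^ m) ^+ 2)) => // N.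
have c0 : 0 <= sigma * (T / 2 ^+ N) by rewrite mulr_ge0 ?divr_ge0 ?exprn_ge0 ?ltW.
have := ball_avg_bounds m c0.
have -> : sigma * (T / 2 ^+ N) * (kap * B ^ m) = sigma * kap * T * B ^ m * 2^-1 ^+ N.
  by rewrite exprVn; ring.
have -> // : (sigma * (T / 2 ^+ N) * B ^ m) ^+ 2 = (sigma * T * B ^ m) ^+ 2 * (2^-1 ^+ N) ^+ 2.
by rewrite exprVn; ring.
Unshelve. all: end_near. Qed.

End BrownianMotion.

Theorem theorem3p1 (R : realType) (p : nat) (b sigma : R)
    (mu : {measure set (QpM R p) -> \bar R}) (P : probability (DM R p) R) :
  prime p -> 0 < b -> 0 < sigma ->
  is_haar mu ->
  P [set w : DM R p | dpath w 0 = zeroQ p] = 1%E ->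
  (forall (ts : seq R) (Us : seq (set (QpM R p))),
      size ts = size Us ->
      path <%R 0 ts ->
      (forall i, (i < size Us)%N -> measurable (nth set0 Us i)) ->
      P [set w : DM R p | forall i, (i < size ts)%N ->
                            nth set0 Us i (dpath w (nth 0 ts i))]
      = fdd_dens mu b sigma (zip ts Us) 0 (zeroQ p)) ->
  forall (T : R) (a : int), 0 <= T ->
    P [set w : DM R p | normT w T <= (p%:R : R) ^ a]
    = (expR (- (sigma * qalpha p b * T * ((p%:R : R) `^ (- (a%:~R * b))))))%:E.
Proof.
by move=> p_pr b_gt0 s_gt0 muH P0 fdd T a T0; exact: (normT_law p_pr muH b_gt0 s_gt0 P0 fdd a T0).
Qed.
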